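(* Let $N\ge 1$ be an integer, set $\ell=\left\lceil \frac{3}{2}N\right\rceil+2$, and let $f_1,\dots,f_N:[-1,1]^N\to\mathbb{R}$. For each integer $M\ge 0$ let $f_i^M$ be the order-$M$ least-squares (Galerkin) Legendre approximation of $f_i$. Assume that 1. $f_i\in C^{\ell}([-1,1]^N)$ for $i=1,\dots,N$; 2. $\theta^\dagger\in(-1,1)^N$ is the unique solution of the nonlinear least-squares problem $\min_{\theta\in[-1,1]^N}\sum_{i=1}^N f_i^2(\theta)$, and $f_i(\theta^\dagger)=0$ for $i=1,\dots,N$; 3. the Jacobian matrix $\nabla \mathbf{f}(\theta^\dagger)$ of $\mathbf{f}:=(f_1,\dots,f_N)^\top$ at $\theta^\dagger$ is invertible. Then there exists a sequence $\{\theta_M^*\}\subset[-1,1]^N$ such that each $\theta^*_M$ is a minimizer of $\sum_{i=1}^N (f_i^M)^2(\theta)$ over $\theta\in[-1,1]^N$, and $\theta_M^*\to\theta^\dagger$ as $M\to+\infty$. Moreover, the residual $\mathbf{f}^M(\theta_M^* )$ converges to $0$ as $M\to+\infty$, where $\mathbf{f}^M:=(f_1^M,\dots,f_N^M)^\top$.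
   Context: Let $p_n$ be the Legendre polynomials on $[-1,1]$ ($p_0=1$, $p_1(x)=x$, $(n+1)p_{n+1}(x)=(2n+1)xp_n(x)-np_{n-1}(x)$), and let $P_n:=\sqrt{n+\tfrac12}\,p_n$ be the normalized Legendre polynomials, which are orthonormal in $L^2([-1,1])$ with respect to Lebesgue measure. For a multi-index $\vec k=(k_1,\dots,k_N)\in\{0,1,2,\dots\}^N$ put $P_{\vec k}(\theta):=\prod_{j=1}^N P_{k_j}(\theta_j)$ and $\|\vec k\|_\infty=\max_j k_j$. The order-$M$ least-squares (Galerkin) approximation of a function $f$ on $[-1,1]^N$ is $f^M(\theta):=\sum_{\|\vec k\|_\infty\le M}\alpha_{\vec k}P_{\vec k}(\theta)$ with $\alpha_{\vec k}=\int_{[-1,1]^N} f(\theta)P_{\vec k}(\theta)\,d\theta$, i.e. the $L^2$-orthogonal projection of $f$ onto $\mathrm{span}\{P_{\vec k}:\|\vec k\|_\infty\le M\}$. *)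

(* Defs.v *)
From HB Require Import structures.
From mathcomp Require Import all_boot all_order all_algebra.
From mathcomp Require Import all_classical all_reals all_analysis.

Set Implicit Arguments.
Unset Strict Implicit.
Unset Printing Implicit Defensive.

Import Order.TTheory GRing.Theory Num.Theory.
Import numFieldNormedType.Exports.

Local Open Scope classical_set_scope.
Local Open Scope ring_scope.

(* The library has binary product measures only: the Lebesgue measure on
   [N]-tuples is built by iterating them along [R * R^n -> R^n.+1]. *)

Section tuple_measure.
Context (R : realType).

Definition pair_cons (n : nat)
    (x : measurableTypeR R * n.-tuple (measurableTypeR R)) :
    n.+1.-tuple (measurableTypeR R) :=
  [the n.+1.-tuple (measurableTypeR R) of x.1 :: x.2].

Lemma measurable_pair_cons (n : nat) : measurable_fun setT (@pair_cons n).
Proof. exact: measurable_cons. Qed.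

Section cons_measure.
Context (n : nat).
Variable m : {sigma_finite_measure set (n.-tuple (measurableTypeR R)) -> \bar R}.

Definition cons_measure : set (n.+1.-tuple (measurableTypeR R)) -> \bar R :=
  pushforward (lebesgue_measure \x m)%E (@pair_cons n).

HB.instance Definition _ := Measure.copy cons_measure
  (measure_function_pushforward__canonical__measure_function_Measure
     (lebesgue_measure \x m)%E (@measurable_pair_cons n)).

Let cons_measure_sigma_finite : sigma_finite setT cons_measure.
Proof.
have /sigma_finiteP[F [TF ndF Foo]] := sigma_finiteT (@lebesgue_measure R).
have /sigma_finiteP[G [TG ndG Goo]] := sigma_finiteT m.
pose g (t : n.+1.-tuple (measurableTypeR R)) :
    measurableTypeR R * n.-tuple (measurableTypeR R) :=
  (tnth t ord0, [tuple of behead t]).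
have gK : cancel (@pair_cons n) g.
  by move=> [x t]; rewrite /g /pair_cons; congr pair; exact: val_inj.
have mg : measurable_fun setT g.
  by apply/measurable_fun_pairP; split;
    [exact: measurable_tnth|exact: measurable_behead].
exists (fun k => g @^-1` (F k `*` G k)).
  apply/esym; rewrite -subTset => t _.
  have [k _ Fk] : (\bigcup_k F k) (g t).1 by rewrite -TF.
  have [j _ Gj] : (\bigcup_k G k) (g t).2 by rewrite -TG.
  exists (maxn k j) => //; split.
    by move: Fk; exact/subsetPset/ndF/leq_maxl.
  by move: Gj; exact/subsetPset/ndG/leq_maxr.
move=> k; have [mFk Fkoo] := Foo k; have [mGk Gkoo] := Goo k; split.
  by rewrite -[X in measurable X]setTI; apply: mg => //; exact: measurableX.
rewrite /cons_measure /pushforward -comp_preimage.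
rewrite (_ : g \o @pair_cons n = id); last by apply/funext => x; exact: gK.
by rewrite preimage_id product_measure1E // lte_mul_pinfty // ge0_fin_numE.
Qed.

HB.instance Definition _ := Measure_isSigmaFinite.Build _ _ _ cons_measure
  cons_measure_sigma_finite.
End cons_measure.

Fixpoint lebesgue_tuple (n : nat) :
    {sigma_finite_measure set (n.-tuple (measurableTypeR R)) -> \bar R} :=
  match n with
  | 0 => dirac ([tuple] : 0.-tuple (measurableTypeR R))
  | n'.+1 => cons_measure (lebesgue_tuple n')
  end.

Lemma lebesgue_tuple_box (n : nat) (A : 'I_n -> set (measurableTypeR R)) :
  (forall i, measurable (A i)) ->
  lebesgue_tuple n [set t | forall i, A i (tnth t i)] =
  (\prod_(i < n) lebesgue_measure (A i))%E.
Proof.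
elim: n A => [|n IH] A mA /=.
  rewrite big_ord0 diracE mem_set //.
  by case.
rewrite big_ord_recl -IH // -product_measure1E //; last first.
  rewrite (_ : [set _ | _] = \bigcap_(i in [set: 'I_n])
      ((@tnth _ _)^~ i @^-1` A (lift ord0 i))).
    apply: fin_bigcap_measurable => [|i _]; first exact: finite_finset.
    rewrite -[X in measurable X]setTI; exact: measurable_tnth.
  by apply/seteqP; split => [t h i _|t h i]; [exact: h|exact: (h i)].
rewrite /cons_measure /pushforward; congr product_measure1.
have tnth_lift x (t : n.-tuple (measurableTypeR R)) j :
    tnth (pair_cons (x, t)) (lift ord0 j) = tnth t j.
  by rewrite tnthS; congr tnth; exact: val_inj.
apply/seteqP; split=> [[x t] /= h|[x t] [/= hx ht] i].
  split; first exact: (h ord0).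
  by move=> i; rewrite /= -(tnth_lift x); exact: h.
by case: (unliftP ord0 i) => [j|] -> //; rewrite tnth_lift; exact: ht.
Qed.

End tuple_measure.

Section legendre.
Context (R : realType).

Fixpoint legendre (n : nat) : {poly R} :=
  match n with
  | 0 => 1
  | n'.+1 =>
    match n' with
    | 0 => 'X
    | m.+1 => n%:R^-1 *:
        ((2 * n' + 1)%:R *: ('X * legendre n') - n'%:R *: legendre m)
    end
  end.

Definition normalized_legendre (n : nat) : {poly R} :=
  Num.sqrt (n%:R + 2^-1) *: legendre n.

Context (N : nat).

Definition multi_legendre (k : 'I_N -> nat) (x : 'rV[R]_N) : R :=
  \prod_(j < N) (normalized_legendre (k j)).[x ord0 j].

Definition cube : set 'rV[R]_N := [set x | forall j, -1 <= x ord0 j <= 1].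

Definition open_cube : set 'rV[R]_N := [set x | forall j, -1 < x ord0 j < 1].

Definition row_of_tuple (t : N.-tuple (measurableTypeR R)) : 'rV[R]_N :=
  \row_j tnth t j.

Definition cube_integral (g : 'rV[R]_N -> R) : R :=
  \int[lebesgue_tuple R N]_(t in row_of_tuple @^-1` cube) g (row_of_tuple t).

Definition legendre_coef (g : 'rV[R]_N -> R) (k : 'I_N -> nat) : R :=
  cube_integral (fun x => g x * multi_legendre k x).

(* The multi-indices with [|k|_oo <= M] are the maps ['I_N -> 'I_M.+1]. *)
Definition galerkin (M : nat) (g : 'rV[R]_N -> R) (x : 'rV[R]_N) : R :=
  \sum_(k : {ffun 'I_N -> 'I_M.+1})
    legendre_coef g (fun j => k j) * multi_legendre (fun j => k j) x.

(* [C^k] on the closed cube: the partial derivatives of order at most [k] exist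
   in the open cube and extend continuously to the closed cube.  Only the
   values of [g] on the cube matter. *)
Fixpoint Ck_cube (k : nat) (g : 'rV[R]_N -> R) : Prop :=
  {within cube, continuous g} /\
  match k with
  | 0 => True
  | k'.+1 => forall j : 'I_N, exists dg : 'rV[R]_N -> R,
      (forall x, open_cube x -> is_derive x (delta_mx ord0 j) g (dg x)) /\
      Ck_cube k' dg
  end.

Definition is_minimizer (A : set 'rV[R]_N) (F : 'rV[R]_N -> R) (x : 'rV[R]_N) :
    Prop :=
  A x /\ forall y, A y -> F x <= F y.

End legendre.

Arguments cube : clear implicits.
Arguments open_cube : clear implicits.

(* Main.v *)
Require Import Defs.
From HB Require Import structures.
From mathcomp Require Import all_boot all_order all_algebra.
From mathcomp Require Import all_classical all_reals all_analysis.
From mathcomp Require Import measurable_realfun.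
From mathcomp Require Import ring lra zify.

Set Implicit Arguments.
Unset Strict Implicit.
Unset Printing Implicit Defensive.

Import Order.TTheory GRing.Theory Num.Theory.
Import numFieldNormedType.Exports.

Local Open Scope classical_set_scope.
Local Open Scope ring_scope.

(** Everything rests on one fact: the truncated Legendre expansions [f_i^M]
    converge to [f_i] uniformly on the closed cube, with error [O(1/M)]
    ([galerkin_rate]).  Granted that, a minimizer [theta_M] of the sum of the
    [(f_i^M)^2] has a sum of squares no larger than the one at [thetad], where
    every [f_i] vanishes; hence the residuals at [theta_M] are [O(1/M)], and so
    are the values [f_i (theta_M)].  Outside a neighbourhood of its only zero
    [thetad] the sum of the [f_i^2] is bounded below on the compact cube, so
    [theta_M] must enter that neighbourhood ([perturbed_minimizers_cvg]).

    The uniform rate is obtained one coordinate at a time.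

    In one variable, the Legendre polynomials are eigenfunctions of the
    Sturm-Liouville operator [L u = -((1 - t^2) u')'] with eigenvalue
    [k (k + 1)], and the weight [1 - t^2] kills the boundary terms when [L] is
    moved onto [u].  So [2q] continuous derivatives make the [k]-th Legendre
    coefficient [O((k (k + 1))^-q)].  Since [|P_k| <= k + 1], the partial sums
    are uniformly Cauchy with an explicit rate, and a function that differs
    from all its late partial sums would be detected by a polynomial peaked at
    a point of discrepancy ([legendre_sum_rate]).

    In [N] variables, the Galerkin projection is the integral operator with
    kernel the product of the one-dimensional kernels [K_M (x_j, t_j)]
    ([galerkinE]), so by Fubini it is an iterated one-dimensional projection.
    Orthonormality gives [\int |K_M (s, t)| dt <= M + 1]
    ([integral_legendre_kernel_norm]); hence each further coordinate multiplies
    the error already made by at most [M + 1] and adds one new one-dimensional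
    error ([tensor_error]).  The total is at most [N (M + 1)^(N - 1)] times the
    one-dimensional error, and [l = ceil (3 N / 2) + 2] leaves enough
    derivatives for the latter to be [O((M + 1)^-(N - 1) / M)].

    Derivatives are available only in the open cube, so the estimates are made
    along segments through points of the open cube and extended to the closed
    cube by continuity at the very end.  Throughout, [J] is [[-1, 1]], [P k]
    the normalized Legendre polynomial and [I u] the integral of [u] on [J]. *)

(** * Legendre polynomials *)

Section legendre_algebra.
Context (R : realType).
Local Notation p n := (legendre R n).

Lemma legendre_rec n :
  n.+2%:R *: p n.+2 = (2 * n + 3)%:R *: ('X * p n.+1) - n.+1%:R *: p n.
Proof.
rewrite [legendre R n.+2]/= scalerA divff ?pnatr_eq0// scale1r.
by congr (_%:R *: _ - _); lia.
Qed.

(** Each of the two identities at rank [n + 1] needs both at rank [n], so they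
    are proved together. *)
Lemma deriv_legendre_rec n :
  (p n.+1)^`() = 'X * (p n)^`() + n.+1%:R *: p n /\
  'X * (p n.+1)^`() - (p n)^`() = n.+1%:R *: p n.+1.
Proof.
elim: n => [|n [IHa IHc]].
  by rewrite /= derivX derivC !mulr0 mulr1 add0r subr0 !scale1r.
have n2 : n.+2%:R != 0 :> R by rewrite pnatr_eq0.
have IHc' : (p n)^`() = 'X * (p n.+1)^`() - n.+1%:R *: p n.+1.
  by rewrite -IHc opprB addrC subrK.
have Ha : (p n.+2)^`() = 'X * (p n.+1)^`() + n.+2%:R *: p n.+1.
  apply: (scalerI n2); have := congr1 (@deriv R) (legendre_rec n).
  rewrite derivZ derivB !derivZ derivM derivX mul1r IHc' => ->.
  rewrite -!mul_polyC !rmorph_nat.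
  move: (p n.+1) ((p n.+1)^`()) => a b; ring.
split => //.
rewrite legendre_rec Ha.
have -> : n.+1%:R *: p n = (p n.+1)^`() - 'X * (p n)^`().
  by rewrite IHa addrC addKr.
rewrite IHc' -!mul_polyC !rmorph_nat.
move: (p n.+1) ((p n.+1)^`()) => a b; ring.
Qed.

Lemma legendre_deriv_sub1X2 n :
  (1 - 'X^2) * (p n.+1)^`() = n.+1%:R *: (p n - 'X * p n.+1).
Proof.
have [IHa IHc] := deriv_legendre_rec n.
have -> : (1 - 'X^2) * (p n.+1)^`() = (p n.+1)^`() -
  'X * ('X * (p n.+1)^`() - (p n)^`()) - 'X * (p n)^`() by ring.
rewrite IHc IHa scalerBr -scalerAr; ring.
Qed.

(** The eigenvalue equation behind orthogonality, the bound on [p_n] and the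
    decay of Legendre coefficients. *)
Lemma legendre_ode n :
  ((1 - 'X^2) * (p n)^`())^`() = - (n * n.+1)%:R *: p n.
Proof.
case: n => [|n]; first by rewrite /= derivC mulr0 derivC mul0n oppr0 scale0r.
have [IHa IHc] := deriv_legendre_rec n.
rewrite legendre_deriv_sub1X2 derivZ derivB derivM derivX mul1r.
have -> : (p n)^`() = 'X * (p n.+1)^`() - n.+1%:R *: p n.+1.
  by rewrite -IHc opprB addrC subrK.
rewrite -!mul_polyC !(rmorphN, rmorph_nat).
move: (p n.+1) ((p n.+1)^`()) => a b; ring.
Qed.

Lemma legendre1 n : (p n).[1] = 1.
Proof.
elim/ltn_ind: n => -[|[|n]] IH; rewrite ?hornerX ?hornerC//.
have n2 : n.+2%:R != 0 :> R by rewrite pnatr_eq0.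
apply: (mulfI n2); rewrite -hornerZ legendre_rec.
rewrite !(hornerD, hornerN, hornerZ, hornerM, hornerX) !IH//; ring.
Qed.

Lemma legendreN1 n : (p n).[-1] = (-1) ^+ n.
Proof.
elim/ltn_ind: n => -[|[|n]] IH; rewrite ?hornerX ?hornerC//.
have n2 : n.+2%:R != 0 :> R by rewrite pnatr_eq0.
apply: (mulfI n2); rewrite -hornerZ legendre_rec.
rewrite !(hornerD, hornerN, hornerZ, hornerM, hornerX) !IH// !exprS; ring.
Qed.

Lemma size_legendre n : size (p n) = n.+1.
Proof.
elim/ltn_ind: n => -[|[|n]] IH; rewrite ?size_polyX ?size_polyC ?oner_neq0//.
have n2 : n.+2%:R != 0 :> R by rewrite pnatr_eq0.
rewrite -(size_scale _ n2) legendre_rec.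
have n3 : (2 * n + 3)%:R != 0 :> R by rewrite pnatr_eq0; lia.
have sX : size ((2 * n + 3)%:R *: ('X * p n.+1)) = n.+3.
  by rewrite size_scale// mulrC size_mulX -?size_poly_gt0 IH.
by rewrite size_polyDl// sX size_polyN size_scale ?pnatr_eq0// IH.
Qed.

(** The energy is chosen so that the differential equation cancels all terms
    but one, whose sign is that of the variable. *)
Lemma legendre_energy_deriv n :
  ((n * n.+1)%:R *: p n ^+ 2 + (1 - 'X^2) * (p n)^`() ^+ 2)^`() =
  2%:R *: ('X * (p n)^`() ^+ 2).
Proof.
have H' : (1 - 'X^2) * (p n)^`()^`() =
    - (n * n.+1)%:R *: p n + 2%:R *: ('X * (p n)^`()).
  rewrite -legendre_ode derivM derivB derivXn derivC -!mul_polyC !rmorph_nat.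
  rewrite -mulr_natl expr1; move: (p n)^`()^`() (p n)^`() => a b; ring.
have -> : ((n * n.+1)%:R *: p n ^+ 2 + (1 - 'X^2) * (p n)^`() ^+ 2)^`() =
    2%:R * ((n * n.+1)%:R *: (p n * (p n)^`())) - 2%:R * 'X * (p n)^`() ^+ 2 +
    2%:R * (p n)^`() * ((1 - 'X^2) * (p n)^`()^`()).
  rewrite !expr2 derivD derivZ !derivM derivB !derivM derivC derivX.
  rewrite -!mul_polyC !rmorph_nat.
  move: (p n)^`()^`() (p n)^`() (p n) => a b c; ring.
rewrite H' -!mul_polyC !(rmorphN, rmorph_nat).
move: (p n) (p n)^`() => a b; ring.
Qed.

(** By [legendre_energy_deriv] the energy decreases on [[-1, 0]] and increases
    on [[0, 1]], so it is largest at an endpoint, where it equals [n (n + 1)]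
    because [p_n] takes the values [1] and [(-1)^n] there. *)
Lemma legendre_le1 n x : -1 <= x <= 1 -> `|(p n).[x]| <= 1.
Proof.
case: n => [|n]; first by rewrite hornerC normr1.
move=> /andP[x1 x2].
pose E := (n.+1 * n.+2)%:R *: p n.+1 ^+ 2 + (1 - 'X^2) * (p n.+1)^`() ^+ 2.
have dE y : E^`().[y] = 2%:R * (y * ((p n.+1)^`()).[y] ^+ 2).
  by rewrite legendre_energy_deriv !(hornerZ, hornerM, hornerX, horner_exp).
have Ex y : E.[y] = (n.+1 * n.+2)%:R * (p n.+1).[y] ^+ 2 +
    (1 - y ^+ 2) * ((p n.+1)^`()).[y] ^+ 2.
  by rewrite !(hornerD, hornerN, hornerZ, hornerM, hornerX, horner_exp, hornerC).
have : E.[x] <= (n.+1 * n.+2)%:R.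
  have dE1 y : (horner E)^`()%classic y = E^`().[y] by rewrite derivE.
  have cE (A : set R) : {within A, continuous (horner E)}.
    by apply: continuous_subspaceT; exact: continuous_horner.
  have dv y : derivable (horner E) y 1 by exact: derivable_horner.
  have [x0|x0] := leP 0 x.
    have -> : (n.+1 * n.+2)%:R = E.[1].
      by rewrite Ex legendre1 !expr1n subrr mul0r addr0 mulr1.
    have := @ger0_derive1_le_cc _ (horner E) 0 1 (fun y _ => dv y).
    apply => //; rewrite ?in_itv/= ?x0 ?x2//.
      by move=> y; rewrite in_itv/= => /andP[y0 _];
       rewrite dE1 dE mulr_ge0// mulr_ge0 ?sqr_ge0// ltW.
    by rewrite ler01 lexx.
  have -> : (n.+1 * n.+2)%:R = E.[-1].
    by rewrite Ex legendreN1 exprAC sqrrN !expr1n subrr mul0r addr0 mulr1.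
  have := @ler0_derive1_le_cc _ (horner E) (-1) 0 (fun y _ => dv y).
  apply => //; rewrite ?in_itv/= ?x1 ?(ltW x0)//; last first.
    by rewrite lexx lerN10.
  move=> y; rewrite in_itv/= => /andP[_ y0].
  by rewrite dE1 dE mulr_ge0_le0// mulr_le0_ge0 ?sqr_ge0// ltW.
rewrite Ex => H.
rewrite -(@ler_pXn2r _ 2) ?nnegrE// real_normK ?num_real// expr1n.
rewrite -(@ler_pM2l _ (n.+1 * n.+2)%:R) ?ltr0n// mulr1 (le_trans _ H)// lerDl.
by rewrite mulr_ge0 ?sqr_ge0//; nra.
Qed.
End legendre_algebra.

Lemma within_continuous_norm (R : realType) (T : topologicalType) (A : set T)
    (h : T -> R) :
  {within A, continuous h} -> {within A, continuous (fun x => `|h x|)}.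
Proof.
by move=> ch x; apply: continuous_comp; [exact: ch|exact: norm_continuous].
Qed.

(** * Integration on the interval [-1, 1] *)

Section interval_integral.
Context (R : realType).
Implicit Types (u v w : R -> R) (p q : {poly R}).

Local Notation J := `[(-1 : R), 1]%classic.
Local Notation mu := (@lebesgue_measure R).
Local Notation I u := (\int[mu]_(t in J) u t).
Definition continuousJ u := {within J, continuous u}.

Lemma continuousJ_horner p : continuousJ (horner p).
Proof. by apply: continuous_subspaceT; exact: continuous_horner. Qed.

Lemma continuousJ_cst c : continuousJ (fun=> c).
Proof. by move=> x; exact: cvg_cst. Qed.

Lemma continuousJD u v :
  continuousJ u -> continuousJ v -> continuousJ (fun t => u t + v t).
Proof. by move=> cu cv x; apply: continuousD; [exact: cu|exact: cv]. Qed.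

Lemma continuousJB u v :
  continuousJ u -> continuousJ v -> continuousJ (fun t => u t - v t).
Proof. by move=> cu cv x; apply: continuousB; [exact: cu|exact: cv]. Qed.

Lemma continuousJM u v :
  continuousJ u -> continuousJ v -> continuousJ (fun t => u t * v t).
Proof. by move=> cu cv x; apply: continuousM; [exact: cu|exact: cv]. Qed.

Lemma continuousJ_norm u : continuousJ u -> continuousJ (fun t => `|u t|).
Proof. exact: within_continuous_norm. Qed.

Lemma integrableJ u : continuousJ u -> mu.-integrable J (EFin \o u).
Proof.
by move=> cu; apply: continuous_compact_integrable => //; exact: segment_compact.
Qed.

Lemma integralJD u v : continuousJ u -> continuousJ v ->
  \int[mu]_(t in J) (u t + v t) = I u + I v.
Proof. by move=> cu cv; rewrite RintegralD//; exact: integrableJ. Qed.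

Lemma integralJB u v : continuousJ u -> continuousJ v ->
  \int[mu]_(t in J) (u t - v t) = I u - I v.
Proof. by move=> cu cv; rewrite RintegralB//; exact: integrableJ. Qed.

Lemma integralJZ c u : continuousJ u -> \int[mu]_(t in J) (c * u t) = c * I u.
Proof. by move=> cu; rewrite RintegralZl//; exact: integrableJ. Qed.

Lemma integralJ_cst c : \int[mu]_(t in J) c = 2 * c.
Proof.
rewrite Rintegral_cst// mulrC; congr (_ * _).
have := @lebesgue_measure_itv R `[-1, 1].
rewrite /= lte_fin ifT; last by lra.
by rewrite -EFinB => /(congr1 fine)/= ->; ring.
Qed.

Lemma le_integralJ u v : continuousJ u -> continuousJ v ->
  (forall t, J t -> u t <= v t) -> I u <= I v.
Proof. by move=> cu cv uv; apply: le_Rintegral => //; exact: integrableJ. Qed.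

Lemma normr_integralJ u : continuousJ u -> `|I u| <= \int[mu]_(t in J) `|u t|.
Proof. by move=> cu; apply: le_normr_Rintegral => //; exact: integrableJ. Qed.

Lemma integralJ_derive (F f : R -> R) : continuousJ F -> continuousJ f ->
  (forall t : R, -1 < t < 1 -> is_derive t 1 F (f t)) -> I f = F 1 - F (-1).
Proof.
move=> cF cf dF; have lt11 : -1 < 1 :> R by lra.
rewrite /Rintegral (continuous_FTC2 (F := F))//.
  have /(continuous_within_itvP _ lt11)[_ cl cr] := cF.
  by split => // t; rewrite in_itv/= => /dF[].
by move=> t; rewrite in_itv/= derive1E => /dF[_ ->].
Qed.

Lemma integralJ_deriv p : I (horner p^`()) = p.[1] - p.[-1].
Proof.
apply: integralJ_derive => *; first exact: continuousJ_horner.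
exact: continuousJ_horner.
Qed.

Lemma integralJ_poly a p q :
  I (horner (a *: p + q)) = a * I (horner p) + I (horner q).
Proof.
rewrite -(integralJZ a (@continuousJ_horner p)) -integralJD//; last 2 first.
- by apply: continuousJM; [exact: continuousJ_cst|exact: continuousJ_horner].
- exact: continuousJ_horner.
by apply: eq_Rintegral => t _; rewrite hornerD hornerZ.
Qed.

Lemma integralJ_polyZ a p : I (horner (a *: p)) = a * I (horner p).
Proof.
rewrite -integralJZ; last exact: continuousJ_horner.
by apply: eq_Rintegral => t _; rewrite hornerZ.
Qed.

Lemma integralJ_polyB p q : I (horner (p - q)) = I (horner p) - I (horner q).
Proof.
have -> : p - q = (-1) *: q + p by rewrite scaleN1r addrC.
by rewrite integralJ_poly addrC mulN1r.
Qed.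

Local Notation p n := (legendre R n).

(** The product of two eigenfunctions is, up to the difference of their
    eigenvalues, the derivative of a Wronskian weighted by [1 - X^2], which
    vanishes at both endpoints. *)
Lemma legendre_orthogonal m n : m != n -> I (horner (p m * p n)) = 0.
Proof.
move=> mn.
pose W := (1 - 'X^2) * (p m)^`() * p n - p m * ((1 - 'X^2) * (p n)^`()).
have : I (horner W^`()) = 0.
  rewrite integralJ_deriv /W !(hornerD, hornerN, hornerM, hornerXn, hornerC).
  by rewrite !hornerX; ring.
have -> : W^`() = ((n * n.+1)%:R - (m * m.+1)%:R) *: (p m * p n).
  rewrite /W derivB !derivM.
  have := legendre_ode R m; have := legendre_ode R n; rewrite !derivM => -> ->.
  rewrite -!mul_polyC !(rmorphB, rmorphN, rmorph_nat).
  move: (p n)^`() (p m)^`() (p n) (p m) => a b c d; ring.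
rewrite integralJ_polyZ => /eqP; rewrite mulf_eq0 subr_eq0 eqr_nat => /orP[|/eqP//].
by move/eqP => E; exfalso; move/eqP: mn; apply; nia.
Qed.

(** Pairing the three-term recurrence at two consecutive ranks with the right
    polynomial expresses the integral of [X p_(n+1) p_(n+2)] through the norms
    of both factors. *)
Lemma legendre_sqnorm n : I (horner (p n * p n)) * (2 * n + 1)%:R = 2.
Proof.
have I1 : I (horner (p 1 * p 1)) = 2 / 3%:R.
  have -> : p 1 * p 1 = 3%:R^-1 *: ('X^3)^`() :> {poly R}.
    rewrite derivXn -[X in _ *: X]scaler_nat scalerA mulVf ?pnatr_eq0//.
    by rewrite scale1r expr2.
  rewrite integralJ_polyZ integralJ_deriv !hornerXn expr1n.
  by rewrite !exprS expr0; field.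
case: n => [|n].
  have -> : p 0 * p 0 = ('X)^`() :> {poly R} by rewrite derivX mulr1.
  by rewrite integralJ_deriv !hornerX muln0 mulr1; ring.
elim: n => [|n IH]; first by rewrite I1 muln1 mulfVK// pnatr_eq0.
have n2 : n.+2%:R != 0 :> R by rewrite pnatr_eq0.
set A := I (horner (p n.+1 * p n.+1)) in IH.
set B := I (horner (p n.+2 * p n.+2)).
pose X := I (horner ('X * p n.+1 * p n.+2)).
have h1 : n.+2%:R * B = (2 * n + 3)%:R * X.
  rewrite -!integralJ_polyZ scalerAl legendre_rec mulrBl integralJ_polyB.
  rewrite -!scalerAl !integralJ_polyZ (@legendre_orthogonal n)// ?mulr0 ?subr0//.
  by apply/eqP; lia.
have h2 : (2 * n + 5)%:R * X = n.+2%:R * A.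
  apply/eqP; rewrite -subr_eq0 -!integralJ_polyZ -integralJ_polyB.
  have -> : (2 * n + 5)%:R *: ('X * p n.+1 * p n.+2) -
      n.+2%:R *: (p n.+1 * p n.+1) = n.+3%:R *: (p n.+3 * p n.+1).
    rewrite [RHS]scalerAl legendre_rec mulrBl -!scalerAl.
    by congr (_ *: _ - _); [congr (_%:R); lia|rewrite mulrAC].
  by rewrite integralJ_polyZ legendre_orthogonal ?mulr0// gtn_eqF.
have -> : B * (2 * n.+2 + 1)%:R = (2 * n + 3)%:R * A.
  apply: (mulfI n2); rewrite mulrA h1 [LHS]mulrAC mulrCA -h2.
  have -> : (2 * n.+2 + 1 = 2 * n + 5)%N by lia.
  ring.
by rewrite mulrC -IH; congr (_ * _%:R); lia.
Qed.
End interval_integral.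

(** * The Legendre kernel *)

Section legendre_series.
Context (R : realType).
Implicit Types (u v w : R -> R) (p q : {poly R}).

Local Notation J := `[(-1 : R), 1]%classic.
Local Notation mu := (@lebesgue_measure R).
Local Notation I u := (\int[mu]_(t in J) u t).
Local Notation P k := (normalized_legendre R k).

Lemma normalized_legendre_orthonormal m n :
  I (horner (P m * P n)) = (m == n)%:R.
Proof.
rewrite /normalized_legendre -scalerAl -scalerAr scalerA integralJ_polyZ.
have [->|mn] := eqVneq m n; last by rewrite legendre_orthogonal// mulr0.
rewrite -expr2 sqr_sqrtr ?addr_ge0//.
have n1 : (2 * n + 1)%:R != 0 :> R by rewrite pnatr_eq0; lia.
apply: (mulIf n1); rewrite -mulrA legendre_sqnorm mul1r.
by rewrite mulrDl mulVf// natrD natrM mulrC.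
Qed.

Lemma normalized_legendre_sqr_le k s : J s -> (P k).[s] ^+ 2 <= k%:R + 2^-1.
Proof.
rewrite /= in_itv/= => /(legendre_le1 k) ple1.
rewrite hornerZ exprMn sqr_sqrtr ?addr_ge0// -[leRHS]mulr1.
rewrite ler_wpM2l ?addr_ge0// -real_normK ?num_real//.
by rewrite expr_le1.
Qed.

Lemma normr_normalized_legendre_le k s : J s -> `|(P k).[s]| <= k.+1%:R.
Proof.
move=> Js; rewrite -(@ler_pXn2r _ 2) ?nnegrE// real_normK ?num_real//.
apply: le_trans (normalized_legendre_sqr_le k Js) _.
by rewrite -[k.+1%:R]natr1; have : 0 <= k%:R :> R by []; nra.
Qed.

Definition legendre_coef1 u k := \int[mu]_(t in J) (u t * (P k).[t]).

(** Integration against this kernel is the orthogonal projection onto the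
    polynomials of degree at most [M]. *)
Definition legendre_kernel (M : nat) (s : R) : {poly R} :=
  \sum_(k < M.+1) (P k).[s] *: P k.

Lemma legendre_kernelE M s t :
  (legendre_kernel M s).[t] = \sum_(k < M.+1) (P k).[s] * (P k).[t].
Proof. by rewrite horner_sum; apply: eq_bigr => k _; rewrite hornerZ. Qed.

Lemma continuousJ_sum n (F : 'I_n -> R -> R) : (forall i, continuousJ (F i)) ->
  continuousJ (fun t => \sum_(i < n) F i t).
Proof.
elim: n F => [|n IH] F cF.
  under [fun t => _]eq_fun do rewrite big_ord0; exact: continuousJ_cst.
under [fun t => _]eq_fun do rewrite big_ord_recl.
by apply: continuousJD => //; apply: IH => i.
Qed.

Lemma integralJ_sum n (F : 'I_n -> R -> R) : (forall i, continuousJ (F i)) ->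
  \int[mu]_(t in J) (\sum_(i < n) F i t) = \sum_(i < n) I (F i).
Proof.
elim: n F => [|n IH] F cF.
  rewrite big_ord0; under eq_Rintegral do rewrite big_ord0.
  by rewrite integralJ_cst mulr0.
rewrite big_ord_recl -IH//; under eq_Rintegral do rewrite big_ord_recl.
by rewrite integralJD//; apply: continuousJ_sum => i.
Qed.

Lemma integral_legendre_kernel u M s : continuousJ u ->
  \int[mu]_(t in J) (u t * (legendre_kernel M s).[t]) =
  \sum_(k < M.+1) legendre_coef1 u k * (P k).[s].
Proof.
move=> cu.
have cuP k : continuousJ (fun t => u t * (P k).[t]).
  by apply: continuousJM => //; exact: continuousJ_horner.
transitivity (\int[mu]_(t in J) \sum_(k < M.+1) (P k).[s] * (u t * (P k).[t])).
  apply: eq_Rintegral => t _; rewrite legendre_kernelE mulr_sumr.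
  by apply: eq_bigr => k _; rewrite mulrCA.
rewrite integralJ_sum => [|k]; last first.
  by apply: continuousJM => //; exact: continuousJ_cst.
by apply: eq_bigr => k _; rewrite integralJZ// mulrC.
Qed.

Lemma legendre_coef1_expansion n (a : 'I_n -> R) k :
  legendre_coef1 (horner (\sum_(i < n) a i *: P i)) k =
  \sum_(i < n) a i * (i == k :> nat)%:R.
Proof.
rewrite /legendre_coef1.
transitivity (\int[mu]_(t in J) \sum_(i < n) a i * (P i * P k).[t]).
  apply: eq_Rintegral => t _; rewrite horner_sum mulr_suml.
  by apply: eq_bigr => i _; rewrite hornerZ hornerM mulrA.
rewrite integralJ_sum => [|i]; last first.
  by apply: continuousJM; [exact: continuousJ_cst|exact: continuousJ_horner].
apply: eq_bigr => i _; rewrite integralJZ ?normalized_legendre_orthonormal//.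
exact: continuousJ_horner.
Qed.

Lemma sum_half_odd M : \sum_(k < M.+1) (k%:R + 2^-1) = M.+1%:R ^+ 2 / 2 :> R.
Proof.
elim: M => [|M IH]; first by rewrite big_ord_recl big_ord0 /=; lra.
rewrite big_ord_recr IH /= -[M.+2%:R]natr1; lra.
Qed.

(** By Parseval the left-hand side is the sum of the [P_k(s)^2], the value of
    the kernel on the diagonal. *)
Lemma integral_legendre_kernel_sqr M s : J s ->
  \int[mu]_(t in J) ((legendre_kernel M s).[t] ^+ 2) <= M.+1%:R ^+ 2 / 2.
Proof.
move=> Js; rewrite -sum_half_odd.
under eq_Rintegral do rewrite expr2.
rewrite integral_legendre_kernel; last exact: continuousJ_horner.
apply: ler_sum => k _; rewrite legendre_coef1_expansion.
rewrite (bigD1 k)//= eqxx mulr1 big1 ?addr0 -?expr2 ?normalized_legendre_sqr_le//.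
by move=> i ik; rewrite (_ : (_ == _) = false) ?mulr0//; apply/negbTE.
Qed.

(** The arithmetic-geometric inequality [|K| <= K^2 / m + m / 4], integrated
    with [m = M + 1], turns the [L^2] bound into an [L^1] bound. *)
Lemma integral_legendre_kernel_norm M s : J s ->
  \int[mu]_(t in J) `|(legendre_kernel M s).[t]| <= M.+1%:R.
Proof.
move=> Js; set K := legendre_kernel M s; set m : R := M.+1%:R.
have m0 : 0 < m by rewrite ltr0n.
have cK : continuousJ (horner K) by exact: continuousJ_horner.
have cK2 : continuousJ (fun t => m^-1 * K.[t] ^+ 2).
  by apply: continuousJM; [exact: continuousJ_cst|exact: continuousJM].
apply: (@le_trans _ _ (\int[mu]_(t in J) (m^-1 * K.[t] ^+ 2 + m / 4))).
  apply: le_integralJ; first exact: continuousJ_norm.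
    by apply: continuousJD => //; exact: continuousJ_cst.
  move=> t _; rewrite -[K.[t] ^+ 2]real_normK ?num_real//.
  move: `|K.[t]| => y; rewrite -subr_ge0.
  have -> : m^-1 * y ^+ 2 + m / 4 - y = m^-1 * (y - m / 2) ^+ 2.
    by field; rewrite gt_eqF.
  by rewrite mulr_ge0 ?sqr_ge0// invr_ge0 ltW.
rewrite integralJD//; last exact: continuousJ_cst.
rewrite integralJ_cst integralJZ; last exact: continuousJM.
have /(ler_wpM2l (ltW _)) := integral_legendre_kernel_sqr M Js.
move=> /(_ m^-1); rewrite invr_gt0 => /(_ m0); rewrite -/K -/m.
have -> : m^-1 * (m ^+ 2 / 2) = m / 2 by field; rewrite gt_eqF.
by move=> H; apply: (le_trans (lerD H (lexx _))); lra.
Qed.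
End legendre_series.

(** * Sturm-Liouville operator and completeness *)

Section legendre_convergence.
Context (R : realType).
Implicit Types (u v w : R -> R) (p q : {poly R}).

Local Notation J := `[(-1 : R), 1]%classic.
Local Notation mu := (@lebesgue_measure R).
Local Notation I u := (\int[mu]_(t in J) u t).
Local Notation P k := (normalized_legendre R k).

Lemma is_deriveM1 (f g : R -> R) (t f' g' : R) :
  is_derive t 1 f f' -> is_derive t 1 g g' ->
  is_derive t 1 (fun x => f x * g x) (f' * g t + f t * g').
Proof.
move=> df dg; rewrite (_ : _ + _ = f t *: g' + g t *: f').
  exact: (@is_deriveM _ _ _ _ t 1 f' g').
by rewrite /GRing.scale/= addrC [g t * _]mulrC.
Qed.

Lemma normalized_legendre_ode k :
  ((1 - 'X^2) * (P k)^`())^`() = - (k * k.+1)%:R *: P k.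
Proof.
rewrite derivZ -scalerAr derivZ legendre_ode !scalerA.
by rewrite mulrC.
Qed.

(** This is [-((1 - t^2) u')'] when [u1] and [u2] are the first two
    derivatives of [u]. *)
Definition sturm_liouville u1 u2 (t : R) := 2 * t * u1 t - (1 - t ^+ 2) * u2 t.

Lemma continuousJ_sturm_liouville u1 u2 : continuousJ u1 -> continuousJ u2 ->
  continuousJ (sturm_liouville u1 u2).
Proof.
move=> c1 c2.
have -> : sturm_liouville u1 u2 =
    fun t => (2%:P * 'X : {poly R}).[t] * u1 t -
      (1 - 'X^2 : {poly R}).[t] * u2 t.
  apply/funext => t.
  by rewrite !(hornerD, hornerN, hornerM, hornerX, hornerXn, hornerC).
by apply: continuousJB; apply: continuousJM => //; exact: continuousJ_horner.
Qed.

(** Green's formula: the difference of the two sides is the integral of the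
    derivative of [(1 - t^2) (u' P_k - u P_k')], which vanishes at both
    endpoints thanks to the weight. *)
Lemma legendre_coef1_sturm_liouville u u1 u2 k :
  continuousJ u -> continuousJ u1 -> continuousJ u2 ->
  (forall t : R, -1 < t < 1 -> is_derive t 1 u (u1 t)) ->
  (forall t : R, -1 < t < 1 -> is_derive t 1 u1 (u2 t)) ->
  (k * k.+1)%:R * legendre_coef1 u k =
  legendre_coef1 (sturm_liouville u1 u2) k.
Proof.
move=> cu cu1 cu2 du du1; have ode := normalized_legendre_ode k.
rewrite /legendre_coef1; move: (P k) ode => Q ode.
pose om : {poly R} := 1 - 'X^2.
have omE t : om.[t] = 1 - t ^+ 2 by rewrite hornerD hornerN hornerXn hornerC.
pose W t := om.[t] * u1 t * Q.[t] - u t * (om * Q^`()).[t].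
pose w t := (k * k.+1)%:R * (u t * Q.[t]) -
  sturm_liouville u1 u2 t * Q.[t].
have cP : continuousJ (horner Q) by exact: continuousJ_horner.
have cW : continuousJ W.
  apply: continuousJB; do 2?apply: continuousJM => //; exact: continuousJ_horner.
have c1 : continuousJ (fun t => (k * k.+1)%:R * (u t * Q.[t])).
  by apply: continuousJM; [exact: continuousJ_cst|exact: continuousJM].
have c2 : continuousJ (fun t => sturm_liouville u1 u2 t * Q.[t]).
  by apply: continuousJM => //; exact: continuousJ_sturm_liouville.
have : I w = W 1 - W (-1).
  apply: integralJ_derive => //; first exact: continuousJB.
  move=> t t11; have {}du := du t t11; have {}du1 := du1 t t11.
  have dom := is_derive_poly om t.
  have dP := is_derive_poly Q t.
  have dQ := is_derive_poly (om * Q^`()) t.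
  have -> : w t = ((om^`().[t] * u1 t + om.[t] * u2 t) * Q.[t] +
      om.[t] * u1 t * Q^`().[t]) -
      (u1 t * (om * Q^`()).[t] + u t * (om * Q^`())^`().[t]).
    rewrite /w ode hornerM hornerZ omE /sturm_liouville.
    rewrite derivB derivC derivXn sub0r hornerN hornerMn hornerXn expr1.
    rewrite -[t *+ 2]mulr_natr; ring.
  apply: is_deriveB; last exact: is_deriveM1.
  by apply: is_deriveM1; exact: is_deriveM1.
rewrite /W !hornerM !omE sqrrN expr1n subrr !mul0r !mulr0 !subr0.
rewrite integralJB// integralJZ; last exact: continuousJM.
by move=> /eqP; rewrite subr_eq0 => /eqP.
Qed.

Lemma continuousJ_bounded u : continuousJ u ->
  exists2 B, 0 < B & forall t, J t -> `|u t| <= B.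
Proof.
move=> cu; have cJ : compact J by exact: segment_compact.
have J0 : J !=set0 by exists 0; rewrite /= in_itv/=; lra.
have [c _ cm] := compact_EVT_max J0 cJ (continuousJ_norm cu).
exists (`|u c| + 1); first by rewrite ltr_wpDl.
by move=> t Jt; apply: ler_wpDr => //; apply: cm; rewrite inE.
Qed.

Lemma le_integralJ_subinterval w a b c : continuousJ w ->
  -1 <= a -> a < b -> b <= 1 ->
  (forall t, J t -> 0 <= w t) -> (forall t, a <= t <= b -> c <= w t) ->
  c * (b - a) <= I w.
Proof.
move=> cw a1 ab b1 w0 wc.
have sub : `[a, b]%classic `<=` J.
  by move=> t; rewrite /= !in_itv/= => /andP[? ?]; apply/andP; split; lra.
have iJ := integrableJ cw.
have iab : mu.-integrable `[a, b] (EFin \o w) by exact: integrableS iJ.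
apply: (@le_trans _ _ (\int[mu]_(t in `[a, b]) w t)).
  have -> : c * (b - a) = \int[mu]_(t in `[a, b]) c.
    rewrite Rintegral_cst//; congr (_ * _).
    have := @lebesgue_measure_itv R `[a, b].
    by rewrite /= lte_fin ab -EFinB => /(congr1 fine)/= ->.
  apply: le_Rintegral => //.
    apply: continuous_compact_integrable => //; first exact: segment_compact.
    by move=> x; exact: cvg_cst.
apply: fine_le; try exact: integrable_fin_num.
apply: ge0_subset_integral => //; first by case/integrableP: iJ.
Qed.

Lemma geometric_lt (a b r r' : R) : 0 <= r -> r < r' -> 0 < b ->
  exists n, a * r ^+ n < b * r' ^+ n.
Proof.
move=> r0 rr' b0; have r'0 : 0 < r' by exact: le_lt_trans rr'.
have q1 : `|r / r'| < 1.
  by rewrite ger0_norm ?divr_ge0// ?(ltW r'0)// ltr_pdivrMr// mul1r.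
have : (fun n => a * (r / r') ^+ n) @ \oo --> a * 0.
  by apply: cvgM; [exact: cvg_cst|exact: cvg_expr].
rewrite mulr0 => /cvgr_lt /(_ b b0) [n _ /(_ n (leqnn n))]/= h.
exists n; move: h; rewrite expr_div_n mulrA ltr_pdivrMr//.
by rewrite exprn_gt0.
Qed.

(** Completeness of the polynomials, in a form that is stable under uniform
    perturbation: one and the same polynomial detects every [w] within [eps] of
    [u].  It is a high power of [1 - (t - s)^2 / 4], whose mass concentrates
    near [s], where all these [w] are bounded below by a positive constant. *)
Lemma continuousJ_orthogonal_test u s eps : continuousJ u -> -1 < s < 1 ->
  eps < u s ->
  exists p, forall w, continuousJ w -> (forall t, J t -> `|w t - u t| <= eps) ->
    0 < \int[mu]_(t in J) (w t * p.[t]).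
Proof.
move=> cu s11 us; pose eta := (u s - eps) / 2.
have eta0 : 0 < eta by rewrite /eta; lra.
have [B B0 uB] := continuousJ_bounded cu.
pose A := B + `|eps|; have A0 : 0 < A by rewrite ltr_pwDl.
have sJ : s \in `](-1 : R), 1[ by rewrite in_itv.
have [d /= d0 dP] : nbhs_ball s (fun t => J t /\ eps + eta < u t).
  apply/nbhs_ballP; have cus : {for s, continuous u}.
    by apply: (within_continuous_continuous _ cu sJ); lra.
  apply: filterI.
    apply: filterS (near_in_itvoo sJ) => t; rewrite /= !in_itv/= => /andP[? ?].
    by apply/andP; split; lra.
  by apply: (cvgr_gt _ cus); rewrite /eta; lra.
pose e := Num.min d 1; have e0 : 0 < e by rewrite lt_min d0 ltr01.
have e1 : e <= 1 by rewrite ge_min lexx orbT.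
have eP t : `|t - s| < e -> J t /\ eps + eta < u t.
  by move=> te; apply: dP; rewrite /ball/= distrC (lt_le_trans te)// ge_min lexx.
have esJ : -1 <= s - e / 2 /\ s + e / 2 <= 1.
  have [] := eP (s - e / 2).
    by rewrite addrC addKr normrN gtr0_norm; lra.
  have [] := eP (s + e / 2).
    by rewrite addrC addKr gtr0_norm; lra.
  by rewrite /= !in_itv/=; lra.
pose r1 : R := 1 - e ^+ 2 / 4; pose r2 : R := 1 - e ^+ 2 / 16.
have r10 : 0 <= r1 by rewrite /r1; nra.
have r12 : r1 < r2 by rewrite /r1 /r2; nra.
(* The base of the peak is at most [r1] beyond distance [e] from [s] and at
   least [r2] within distance [e / 2], so for large [n] the mass near [s]
   outweighs the contribution of the rest of the interval. *)
have [n nP] := geometric_lt (2 * A) r10 r12 (mulr_gt0 eta0 e0).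
pose b : {poly R} := 1 - (4^-1 *: ('X - s%:P) ^+ 2).
have bE t : b.[t] = 1 - (t - s) ^+ 2 / 4.
  rewrite hornerD hornerN hornerZ horner_exp hornerD hornerN hornerX !hornerC.
  by rewrite mulrC.
exists (b ^+ n) => w cw wu.
have wA t : J t -> `|w t| <= A.
  move=> Jt; rewrite -(subrK (u t) (w t)) addrC (le_trans (ler_normD _ _))//.
  by rewrite lerD ?uB// (le_trans (wu t Jt)) ?ler_norm.
have w_eta t : `|t - s| < e -> eta <= w t.
  move=> te; have [Jt ut] := eP t te.
  by have := wu t Jt; rewrite ler_norml => /andP[h _]; lra.
have b01 t : J t -> 0 <= b.[t].
  by rewrite /= in_itv/= bE => /andP[? ?]; nra.
have cb : continuousJ (fun t => w t * (b ^+ n).[t]).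
  by apply: continuousJM => //; exact: continuousJ_horner.
have r1n0 : 0 <= A * r1 ^+ n by rewrite mulr_ge0 ?exprn_ge0// ltW.
(* Adding [A * r1 ^+ n] makes the integrand nonnegative on all of [J]. *)
have : eta * r2 ^+ n * (s + e / 2 - (s - e / 2)) <=
    \int[mu]_(t in J) (w t * (b ^+ n).[t] + A * r1 ^+ n).
  apply: le_integralJ_subinterval; [|lra|lra|lra|..].
  - by apply: continuousJD => //; exact: continuousJ_cst.
  - move=> t Jt; rewrite horner_exp; have [te|te] := ltP `|t - s| e.
      by rewrite addr_ge0// mulr_ge0 ?exprn_ge0 ?b01// (le_trans _ (w_eta _ te))// ltW.
    have : `|w t * b.[t] ^+ n| <= A * r1 ^+ n.
      rewrite normrM ler_pM// ?wA// ger0_norm ?exprn_ge0 ?b01//.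
      rewrite lerXn2r ?nnegrE ?b01// bE /r1 lerD2l lerN2.
      rewrite ler_pM2r ?invr_gt0// -[leRHS]real_normK ?num_real//.
      by rewrite lerXn2r// nnegrE// ltW.
    by rewrite ler_norml => /andP[h _]; lra.
  - move=> t te; have te' : `|t - s| <= e / 2 by rewrite ler_norml; lra.
    rewrite ler_wpDr// horner_exp ler_pM ?exprn_ge0 ?(ltW eta0)//.
    + by apply: le_trans r10 _; exact: ltW.
    + by apply: w_eta; lra.
    rewrite lerXn2r ?nnegrE//.
    + by apply: le_trans r10 _; exact: ltW.
    + by apply: b01; apply: (proj1 (eP t _)); lra.
    rewrite bE /r2 lerD2l lerN2 -[(t - s) ^+ 2]real_normK ?num_real//.
    by have : 0 <= `|t - s| by []; nra.
rewrite integralJD//; last exact: continuousJ_cst.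
rewrite integralJ_cst.
have -> : s + e / 2 - (s - e / 2) = e by lra.
by move=> h; move: nP; rewrite -mulrA mulrAC => nP; lra.
Qed.
End legendre_convergence.

(** * Uniform rate of convergence in one variable *)

Section legendre_rate.
Context (R : realType).
Implicit Types (u v w : R -> R) (p q : {poly R}).

Local Notation J := `[(-1 : R), 1]%classic.
Local Notation mu := (@lebesgue_measure R).
Local Notation I u := (\int[mu]_(t in J) u t).
Local Notation P k := (normalized_legendre R k).

Lemma size_normalized_legendre k : size (P k) = k.+1.
Proof. by rewrite size_scale ?size_legendre// gt_eqF// sqrtr_gt0 ltr_wpDl. Qed.

Lemma orthogonal_low_degree w m : continuousJ w ->
  (forall k, (k < m)%N -> legendre_coef1 w k = 0) ->
  forall p, (size p <= m)%N -> \int[mu]_(t in J) (w t * p.[t]) = 0.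
Proof.
move=> cw; elim: m => [|m IH] w0 p sp.
  move: sp; rewrite leqn0 size_poly_eq0 => /eqP ->.
  under eq_Rintegral do rewrite hornerC mulr0.
  by rewrite integralJ_cst mulr0.
pose a := p`_m / lead_coef (P m); pose r := p - a *: P m.
have sr : (size r <= m)%N.
  apply/leq_sizeP => j; rewrite leq_eqVlt => /predU1P[<-|mj].
    rewrite coefB coefZ /a /lead_coef size_normalized_legendre/= divfK ?subrr//.
    have -> : (P m)`_m = lead_coef (P m).
      by rewrite /lead_coef size_normalized_legendre.
    by rewrite lead_coef_eq0 -size_poly_eq0 size_normalized_legendre.
  rewrite coefB coefZ !nth_default ?mulr0 ?subrr ?size_normalized_legendre//.
  exact: leq_trans sp _.
have cwP q : continuousJ (fun t => w t * q.[t]).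
  by apply: continuousJM => //; exact: continuousJ_horner.
transitivity (\int[mu]_(t in J) (w t * r.[t] + a * (w t * (P m).[t]))).
  apply: eq_Rintegral => t _; rewrite hornerD hornerN hornerZ; ring.
rewrite integralJD//; last by apply: continuousJM => //; exact: continuousJ_cst.
rewrite integralJZ// IH// => [|k km]; last by rewrite w0// ltnW.
by rewrite -/(legendre_coef1 w m) w0// mulr0 addr0.
Qed.

Definition legendre_sum u M : {poly R} :=
  \sum_(k < M.+1) legendre_coef1 u k *: P k.

Lemma legendre_coef1_sum u M k : (k <= M)%N ->
  legendre_coef1 (horner (legendre_sum u M)) k = legendre_coef1 u k.
Proof.
move=> kM; rewrite legendre_coef1_expansion -ltnS in kM *.
rewrite (bigD1 (Ordinal kM))//= eqxx mulr1 big1 ?addr0// => i ik.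
rewrite (_ : (_ == _) = false) ?mulr0//; apply/negbTE.
by apply: contra ik => /eqP ik; apply/eqP/val_inj.
Qed.

(** The exponent count of the whole proof: decay of order [2q] pays for the
    size [k + 1] of [P_k], for [r] powers of [k] that are needed later, and
    for a summable [k^-2]. *)
Lemma expn_pronic_ge (k q r : nat) : (r + 3 <= 2 * q)%N ->
  (k.+1 * k ^ r.+2 <= (k * k.+1) ^ q)%N.
Proof.
case: q => [|q] rq; first by lia.
have [->|k0] := posnP k; first by rewrite exp0n// muln0.
rewrite [leqRHS]expnS -mulnA mulnCA leq_mul2l /=.
apply: (@leq_trans (k * (k * k) ^ q)).
  by rewrite mulnn -expnM -expnS leq_pexp2l//; lia.
by rewrite leq_mul2l leq_exp2r ?leq_mul2l ?leqnSn ?orbT//; lia.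
Qed.

Section tail.
Variables (u : R -> R) (B : R) (q r : nat).
Hypotheses (cu : continuousJ u) (rq : (r + 3 <= 2 * q)%N).
Hypothesis coefB : forall k, `|legendre_coef1 u k| * ((k * k.+1) ^ q)%:R <= B.

Let B0 : 0 <= B.
Proof. by apply: le_trans (coefB 0); rewrite mulr_ge0. Qed.

(** The difference of inverses makes the sum over [k] telescope. *)
Lemma legendre_sum_increment M k s : J s -> (0 < M)%N -> (M <= k)%N ->
  `|legendre_coef1 u k.+1 * (P k.+1).[s]| <=
  B / M.+1%:R ^+ r * (k%:R^-1 - k.+1%:R^-1).
Proof.
move=> Js M0 Mk; have k0 : (0 < k)%N by exact: leq_trans Mk.
have D0 : 0 < (k.+1 * k.+2) %:R ^+ q :> R by rewrite exprn_gt0// ltr0n.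
have c_le : `|legendre_coef1 u k.+1| <= B / (k.+1 * k.+2)%:R ^+ q.
  by rewrite ler_pdivlMr// -natrX coefB.
rewrite normrM (le_trans (ler_pM _ _ c_le (normr_normalized_legendre_le _ Js)))//.
rewrite -!mulrA ler_wpM2l// mulrC ler_pdivrMr//.
have h : (k.+2 * k.+1 ^ r.+2 <= (k.+1 * k.+2) ^ q)%N by exact: expn_pronic_ge.
have -> : k%:R^-1 - k.+1%:R^-1 = (k * k.+1)%:R^-1 :> R.
  rewrite -[k.+1%:R]natr1 natrM -[k.+1%:R]natr1; field.
  by rewrite natr1 !pnatr_eq0/= -lt0n.
rewrite -invfM mulrC ler_pdivlMr ?mulr_gt0 ?exprn_gt0 ?ltr0n//; last by lia.
rewrite -!natrX -!natrM ler_nat (leq_trans _ h)// leq_mul2l /= !expnS.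
rewrite mulnC -mulnA; apply: leq_mul; first by lia.
by rewrite leq_mul2l; case: (r) => // r'; rewrite leq_exp2r ?orbT//; lia.
Qed.

Lemma legendre_sum_cauchy M M' s : J s -> (0 < M)%N -> (M <= M')%N ->
  `|(legendre_sum u M').[s] - (legendre_sum u M).[s]| <=
  B / M.+1%:R ^+ r * (M%:R^-1 - M'%:R^-1).
Proof.
move=> Js M0; elim: M' => [|k IH]; first by rewrite leqNgt M0.
rewrite leq_eqVlt => /predU1P[<-|]; first by rewrite !subrr normr0 mulr0.
rewrite ltnS => Mk; have {IH} := IH Mk.
have -> : (legendre_sum u k.+1).[s] = (legendre_sum u k).[s] +
    legendre_coef1 u k.+1 * (P k.+1).[s].
  by rewrite /legendre_sum big_ord_recr/= hornerD hornerZ.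
move=> IH; have := legendre_sum_increment Js M0 Mk.
rewrite addrAC -[X in _ -> _ <= _ * X](addrNK k%:R^-1) => h.
rewrite (le_trans (ler_normD _ _))//.
rewrite [X in _ <= _ * X](_ : _ =
  (M%:R^-1 - k%:R^-1) + (k%:R^-1 - k.+1%:R^-1)); last by ring.
by rewrite mulrDr lerD.
Qed.

Lemma continuousJ_legendre_residual M :
  continuousJ (fun t => u t - (legendre_sum u M).[t]).
Proof. by apply: continuousJB => //; exact: continuousJ_horner. Qed.

Lemma legendre_residual_orthogonal M p : (size p <= M.+1)%N ->
  \int[mu]_(t in J) ((u t - (legendre_sum u M).[t]) * p.[t]) = 0.
Proof.
apply: orthogonal_low_degree; first exact: continuousJ_legendre_residual.
move=> k kM; rewrite /legendre_coef1.
have cP : continuousJ (horner (P k)) by exact: continuousJ_horner.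
transitivity (\int[mu]_(t in J)
    (u t * (P k).[t] - (legendre_sum u M).[t] * (P k).[t])).
  by apply: eq_Rintegral => t _; rewrite mulrBl.
rewrite integralJB//; try by apply: continuousJM => //; exact: continuousJ_horner.
rewrite -/(legendre_coef1 (horner (legendre_sum u M)) k).
by rewrite -/(legendre_coef1 u k) legendre_coef1_sum// subrr.
Qed.

(** If the gap at [s] exceeded the Cauchy bound, every later residual would
    stay within that bound of the present one, so a single polynomial would
    have a positive integral against all of them; but the residual of large
    order is orthogonal to it. *)
Theorem legendre_sum_rate M s : (0 < M)%N -> -1 < s < 1 ->
  `|(legendre_sum u M).[s] - u s| <= B / (M%:R * M.+1%:R ^+ r).
Proof.
move=> M0 s11; set eps := B / _; rewrite leNgt; apply/negP => gap.
pose e t := u t - (legendre_sum u M).[t].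
have near M' t : J t -> (M <= M')%N ->
    `|(legendre_sum u M').[t] - (legendre_sum u M).[t]| <= eps.
  move=> Jt MM'; apply: le_trans (legendre_sum_cauchy Jt M0 MM') _.
  rewrite /eps invfM mulrCA mulrC ler_wpM2r//.
    by rewrite divr_ge0 ?exprn_ge0.
  by rewrite lerBlDr lerDl invr_ge0.
(* The sign [sg] reduces to a residual that is too large from above. *)
have contra (sg : R) : `|sg| = 1 -> eps < sg * e s -> False.
  move=> sg1 es.
  have ce M' : continuousJ (fun t => sg * (u t - (legendre_sum u M').[t])).
    apply: continuousJM; first exact: continuousJ_cst.
    exact: continuousJ_legendre_residual.
  have [p /(_ _ (ce (maxn M (size p))))] :=
    continuousJ_orthogonal_test (ce M) s11 es.
  set M' := maxn _ _.
  have c1 : continuousJ (fun t => (u t - (legendre_sum u M').[t]) * p.[t]).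
    apply: continuousJM; last exact: continuousJ_horner.
    exact: continuousJ_legendre_residual.
  have -> : \int[mu]_(t in J) (sg * (u t - (legendre_sum u M').[t]) * p.[t]) = 0.
    under eq_Rintegral do rewrite -mulrA.
    rewrite integralJZ// legendre_residual_orthogonal ?mulr0//.
    by rewrite (leq_trans (leq_maxr M _)).
  rewrite ltxx => H; suff: false by []; apply: H => t Jt.
  rewrite -mulrBr normrM sg1 mul1r opprB addrC addrA subrK distrC.
  by apply: near => //; exact: leq_maxl.
move: gap; rewrite distrC -/(e s); have [e0|e0] := leP 0 (e s).
  by rewrite ger0_norm// => gap; apply: (contra 1); rewrite ?normr1 ?mul1r.
by rewrite ltr0_norm// => gap; apply: (contra (-1)); rewrite ?normrN1 ?mulN1r.
Qed.
End tail.
End legendre_rate.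

(** * Integration on the box of tuples *)

Section tuple_integral.
Context (R : realType).

Local Notation J := `[(-1 : R), 1]%classic.
Local Notation mu := (@lebesgue_measure R).
Local Notation tup n := (n.-tuple (measurableTypeR R)).

Definition box n : set (tup n) := [set t | forall i, J (tnth t i)].
Arguments box : clear implicits.

Lemma measurable_box n : measurable (box n).
Proof.
rewrite (_ : box n = \bigcap_(i in [set: 'I_n]) ((@tnth _ _)^~ i @^-1` J)).
  apply: fin_bigcap_measurable => [|i _]; first exact: finite_finset.
  rewrite -[X in measurable X]setTI; exact: measurable_tnth.
by apply/seteqP; split => [t h i _|t h i]; [exact: h|exact: (h i)].
Qed.

Lemma lebesgue_tuple_box_lty n : (lebesgue_tuple R n (box n) < +oo)%E.
Proof.
rewrite (lebesgue_tuple_box (A := fun=> J))//.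
suff /andP[] : (0 <= \prod_(i < n) mu J < +oo)%E by [].
apply: (big_ind (fun x : \bar R => 0 <= x < +oo)%E).
- by rewrite lee01 ltry.
- move=> x y /andP[x0 xoo] /andP[y0 yoo]; rewrite mule_ge0//=.
  by rewrite lte_mul_pinfty// ge0_fin_numE.
- move=> i _; rewrite measure_ge0/=.
  have := @lebesgue_measure_itv R `[-1, 1].
  by move=> ->; case: ifP => _; rewrite ltry.
Qed.

Lemma integrable_box n (phi : tup n -> R) B : measurable_fun setT phi ->
  (forall t, box n t -> `|phi t| <= B) ->
  (lebesgue_tuple R n).-integrable (box n) (EFin \o phi).
Proof.
move=> mphi phiB; apply: measurable_bounded_integrable.
- exact: measurable_box.
- exact: lebesgue_tuple_box_lty.
- exact: measurable_funTS.
- exists B; split; first exact: num_real.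
  by move=> x Bx t /= /phiB h; apply: le_trans h (ltW Bx).
Qed.

Lemma measurable_cons_section n (phi : tup n.+1 -> R) x :
  measurable_fun setT phi -> measurable_fun setT (fun y => phi (pair_cons (x, y))).
Proof.
move=> mphi; apply: (measurableT_comp mphi).
exact: (measurableT_comp (@measurable_pair_cons R n)).
Qed.

Lemma box_cons n x (y : tup n) : box n.+1 (pair_cons (x, y)) <-> J x /\ box n y.
Proof.
split=> [h|[hx hy] i].
  split; first exact: (h ord0).
  move=> i; have := h (lift ord0 i); rewrite tnthS.
  by congr J; congr tnth; exact: val_inj.
case: (unliftP ord0 i) => [j|] ->; last exact: hx.
have -> : tnth (pair_cons (x, y)) (lift ord0 j) = tnth y j.
  by rewrite tnthS; congr tnth; exact: val_inj.
exact: hy.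
Qed.

Section cons.
Context n (phi : tup n.+1 -> R) (B : R).
Hypotheses (mphi : measurable_fun setT phi)
  (phiB : forall t, box n.+1 t -> `|phi t| <= B).

Let phi' := fun z : measurableTypeR R * tup n =>
  ((phi \_ (box n.+1)) (pair_cons z))%:E.

Let m2 := [the {sigma_finite_measure set (measurableTypeR R) -> \bar R} of mu].

Let mphi_box : measurable_fun setT (phi \_ (box n.+1)).
Proof.
have := (measurable_restrictT phi (@measurable_box n.+1)).1.
by apply; exact: measurable_funTS.
Qed.

Let integrable_phi' : (m2 \x lebesgue_tuple R n)%E.-integrable setT phi'.
Proof.
have mD : measurable (@pair_cons R n @^-1` box n.+1).
  rewrite -[X in measurable X]setTI; apply: measurable_pair_cons => //.
  exact: measurable_box.
have -> : phi' =
    (EFin \o (phi \o @pair_cons R n)) \_ (@pair_cons R n @^-1` box n.+1).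
  apply/funext => z; rewrite /phi' /patch /=.
  have -> : (z \in @pair_cons R n @^-1` box n.+1) =
      (pair_cons z \in box n.+1).
    by apply/idP/idP => /set_mem h; exact/mem_set.
  by case: ifPn.
apply/(integrable_mkcond _ mD).1; apply: measurable_bounded_integrable => //.
- exact: (lebesgue_tuple_box_lty n.+1).
- apply: measurable_funTS; apply: (measurableT_comp mphi).
  exact: measurable_pair_cons.
- exists B; split; first exact: num_real.
  by move=> x Bx t /= /phiB h; apply: le_trans h (ltW Bx).
Qed.

Let phi'E x : fubini_F (lebesgue_tuple R n) phi' x =
  (((fun x => \int[lebesgue_tuple R n]_(y in box n)
      phi (pair_cons (x, y))) \_ J) x)%:E.
Proof.
rewrite /fubini_F /phi' /patch; case: ifPn => [/set_mem Jx|Jx].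
  rewrite fineK; last first.
    apply: integrable_fin_num; first exact: measurable_box.
    apply: (integrable_box (B := B)); first exact: measurable_cons_section.
    by move=> y hy; apply: phiB; exact/box_cons.
  rewrite [RHS]integral_mkcond; apply: eq_integral => y _; rewrite /patch.
  have -> : (pair_cons (x, y) \in box n.+1) = (y \in box n).
    apply/idP/idP => /set_mem h; apply/mem_set; last exact/box_cons.
    by have /box_cons[] := h.
  by case: ifPn.
apply: integral0_eq => y _; case: ifPn => // /set_mem/box_cons[Jx' _].
by rewrite mem_set in Jx.
Qed.

Lemma integrable_tuple_cons : mu.-integrable J
  (fun x => (\int[lebesgue_tuple R n]_(y in box n) phi (pair_cons (x, y)))%:E).
Proof.
apply/integrable_mkcond => //.
have := integrable_fubini_F integrable_phi'.
apply: eq_integrable => // x _; rewrite phi'E /patch; by case: ifPn.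
Qed.

Lemma integral_tuple_cons :
  \int[lebesgue_tuple R n.+1]_(t in box n.+1) phi t =
  \int[mu]_(x in J) \int[lebesgue_tuple R n]_(y in box n) phi (pair_cons (x, y)).
Proof.
rewrite [RHS]/Rintegral [X in _ = fine X]integral_mkcond.
transitivity (fine (\int[m2]_x fubini_F (lebesgue_tuple R n) phi' x)); last first.
  by congr fine; apply: eq_integral => x _; rewrite phi'E /patch; case: ifPn.
rewrite integral12_prod_meas1//.
congr fine.
rewrite integral_mkcond restrict_EFin.
apply: (@integral_pushforward _ _ _ _ R
  (@pair_cons R n) (@measurable_pair_cons R n)
  (m2 \x lebesgue_tuple R n)%E setT (EFin \o (phi \_ (box n.+1)))) => //.
exact/measurable_EFinP.
Qed.
End cons.
End tuple_integral.
Arguments box : clear implicits.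

(** * Tensor products of approximate identities *)

Section tensor.
Context (R : realType).

Local Notation J := `[(-1 : R), 1]%classic.
Local Notation mu := (@lebesgue_measure R).
Local Notation tup n := (n.-tuple (measurableTypeR R)).

(** The endpoints are negligible, so a bound known only in the open interval
    suffices. *)
Lemma integral_open_bound (w b : R -> R) :
  mu.-integrable J (EFin \o w) -> mu.-integrable J (EFin \o b) ->
  (forall t : R, -1 < t < 1 -> `|w t| <= b t) ->
  `|\int[mu]_(t in J) w t| <= \int[mu]_(t in J) b t.
Proof.
have J_open (v : R -> R) : mu.-integrable J (EFin \o v) ->
    mu.-integrable `](-1 : R), 1[ (EFin \o v) /\
    \int[mu]_(t in J) v t = \int[mu]_(t in `](-1 : R), 1[) v t.
  move=> iv.
  have i1 : mu.-integrable `](-1 : R), 1] (EFin \o v).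
    by apply: integrableS iv => // t; rewrite /= !in_itv/=; lra.
  have i2 : mu.-integrable `](-1 : R), 1[ (EFin \o v).
    by apply: integrableS iv => // t; rewrite /= !in_itv/=; lra.
  by split => //; rewrite -Rintegral_itv_obnd_cbnd// -Rintegral_itv_bndo_bndc.
move=> /J_open[iw ->] /J_open[ib ->] wb.
apply: le_trans (le_normr_Rintegral _ iw) _ => //.
apply: le_Rintegral => //.
exact: integrable_norm iw.
Qed.

Definition open_box n (x : tup n) := forall i, -1 < tnth x i < 1.

Definition tuple_line n (x : tup n) (j : 'I_n) (s : R) : tup n :=
  [tuple (if i == j then s else tnth x i) | i < n].

Context (K : R -> R -> R) (Lam eps : R).
Hypothesis K_cont : forall s, continuousJ (K s).
Hypothesis K_meas : forall s, measurable_fun setT (K s).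
Hypothesis K_norm : forall s : R, -1 < s < 1 -> \int[mu]_(t in J) `|K s t| <= Lam.

Definition tensor_kernel n (x t : tup n) : R :=
  \prod_(j < n) K (tnth x j) (tnth t j).

Lemma measurable_tensor_kernel n (x : tup n) :
  measurable_fun setT (tensor_kernel x).
Proof.
apply: measurable_prod => j _.
exact: (measurableT_comp (K_meas _) (measurable_tnth j)).
Qed.

Lemma tensor_kernel_bounded n (x : tup n) :
  exists2 C, 0 <= C & forall t, box R n t -> `|tensor_kernel x t| <= C.
Proof.
have /choice[C CP] : forall j : 'I_n, exists C : R,
    forall t, J t -> `|K (tnth x j) t| <= C.
  by move=> j; have [B _ BP] := continuousJ_bounded (@K_cont (tnth x j)); exists B.
have J0 : J 0 by rewrite /= in_itv/=; lra.
exists (\prod_(j < n) C j).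
  by apply: prodr_ge0 => j _; apply: le_trans (CP j 0 J0).
move=> t ht; rewrite normr_prod; apply: ler_prod => j _.
by rewrite normr_ge0 CP.
Qed.

Lemma tensor_kernel_cons n s (x : tup n) t y :
  tensor_kernel (pair_cons (s, x)) (pair_cons (t, y)) = K s t * tensor_kernel x y.
Proof.
rewrite /tensor_kernel big_ord_recl; congr (_ * _); apply: eq_bigr => j _.
rewrite !tnthS; congr (K (tnth _ _) (tnth _ _)); exact: val_inj.
Qed.

(** Integrate the last coordinates first.  By induction the inner integral is
    within [eps * \sum_(j < n) Lam ^+ j] of the section of [h], integration
    against [K s] costs a factor [Lam], and replacing the section of [h] along
    the first coordinate by its value costs a further [eps]. *)
Lemma tensor_error n (h : tup n -> R) B :
  measurable_fun setT h -> (forall t, `|h t| <= B) ->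
  (forall x j, open_box x ->
    `|\int[mu]_(t in J) (h (tuple_line x j t) * K (tnth x j) t) - h x| <= eps) ->
  forall x, open_box x ->
    `|\int[lebesgue_tuple R n]_(t in box R n) (h t * tensor_kernel x t) - h x|
    <= eps * \sum_(j < n) Lam ^+ j.
Proof.
elim: n h => [|n IH] h mh hB herr x x11.
  rewrite big_ord0 mulr0 normr_le0 subr_eq0; apply/eqP.
  rewrite /Rintegral integral_dirac//; last 2 first.
  - exact: measurable_box.
  - apply/measurable_EFinP; apply: measurable_funTS; apply: measurable_funM => //.
    exact: measurable_tensor_kernel.
  rewrite diracE mem_set ?mul1e/=; last by case.
  by rewrite /tensor_kernel big_ord0 mulr1 (tuple0 x).
pose s := tnth x ord0; pose x' : tup n := [tuple of behead x].
have xE : x = pair_cons (s, x').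
  by apply: val_inj => /=; rewrite /s /x' /= [x]tuple_eta.
have s11 : -1 < s < 1 by exact: x11.
have tnth_cons a (y : tup n) i : tnth (pair_cons (a, y)) (lift ord0 i) = tnth y i.
  by rewrite tnthS; congr tnth; exact: val_inj.
have x'11 : open_box x' by move=> i; rewrite -(tnth_cons s) -xE; exact: x11.
have open_cons t (y : tup n) :
    -1 < t < 1 -> open_box y -> open_box (pair_cons (t, y)).
  move=> t11 y11 i; case: (unliftP ord0 i) => [i'|] ->; last exact: t11.
  by rewrite tnth_cons.
pose g t := \int[lebesgue_tuple R n]_(y in box R n)
  (h (pair_cons (t, y)) * tensor_kernel x' y).
have gerr t : -1 < t < 1 ->
    `|g t - h (pair_cons (t, x'))| <= eps * \sum_(j < n) Lam ^+ j.
  move=> t11; apply: (IH (fun y => h (pair_cons (t, y)))) => //.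
    exact: measurable_cons_section.
  move=> y j y11.
  have := herr _ (lift ord0 j) (open_cons _ _ t11 y11).
  rewrite tnth_cons; congr (`| _ - _| <= _).
  apply: eq_Rintegral => a _; congr (h _ * _).
  apply: eq_from_tnth => i; rewrite tnth_mktuple.
  case: (unliftP ord0 i) => [i'|] -> //.
  by rewrite !tnth_cons tnth_mktuple (inj_eq lift_inj).
set c := eps * _ in gerr.
have Lam0 : 0 <= Lam.
  by apply: le_trans (K_norm s11); apply: Rintegral_ge0 => t _.
have eps0 : 0 <= eps by apply: le_trans (herr x ord0 x11).
have c0 : 0 <= c by rewrite mulr_ge0// sumr_ge0// => j _; rewrite exprn_ge0.
have [C C0 CP] := tensor_kernel_bounded x.
have mphi : measurable_fun setT (fun t => h t * tensor_kernel x t).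
  by apply: measurable_funM => //; exact: measurable_tensor_kernel.
have phiB t : box R n.+1 t -> `|h t * tensor_kernel x t| <= B * C.
  by move=> ht; rewrite normrM ler_pM// CP.
have gE : (fun a => \int[lebesgue_tuple R n]_(y in box R n)
    (h (pair_cons (a, y)) * tensor_kernel x (pair_cons (a, y)))) =
    (fun a => K s a * g a).
  apply/funext => a; rewrite /g -RintegralZl.
  - by apply: eq_Rintegral => y _; rewrite xE tensor_kernel_cons mulrCA.
  - exact: measurable_box.
  have [D D0 DP] := tensor_kernel_bounded x'.
  apply: (integrable_box (B := B * D)).
    apply: measurable_funM; last exact: measurable_tensor_kernel.
    exact: measurable_cons_section.
  by move=> y hy; rewrite normrM ler_pM// DP.
have iKg : mu.-integrable J (EFin \o (fun a => K s a * g a)).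
  by rewrite -gE; exact: integrable_tuple_cons mphi phiB.
rewrite (integral_tuple_cons mphi phiB) gE.
have upd a : tuple_line x ord0 a = pair_cons (a, x').
  apply: eq_from_tnth => i; rewrite tnth_mktuple.
  case: (unliftP ord0 i) => [i'|] -> //=.
  by rewrite tnth_cons xE tnth_cons.
have := herr x ord0 x11; under eq_Rintegral do rewrite upd.
move=> err0.
have iKh : mu.-integrable J (EFin \o (fun a => h (pair_cons (a, x')) * K s a)).
  have [D D0 DP] := continuousJ_bounded (@K_cont s).
  apply: measurable_bounded_integrable => //.
  - by apply: compact_finite_measure; exact: segment_compact.
  - apply: measurable_funTS; apply: measurable_funM; last exact: K_meas.
    apply: (measurableT_comp mh).
    apply: (measurableT_comp (@measurable_pair_cons R n)).
    exact: pair2_measurable.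
  - exists (B * D); split; first exact: num_real.
    move=> b Bb a /= Ja; apply: le_trans (ltW Bb).
    by rewrite normrM ler_pM// DP.
rewrite big_ord_recl expr0 mulrDr mulr1.
rewrite -(subrKA (\int[mu]_(a in J) (h (pair_cons (a, x')) * K s a))).
rewrite addrC (le_trans (ler_normD _ _))// addrC.
rewrite addrC lerD//.
rewrite -RintegralB//.
apply: (@le_trans _ _ (\int[mu]_(a in J) (`|K s a| * c))).
  apply: integral_open_bound.
  - have := @integrableB _ _ _ mu _ _ _ _ iKg iKh.
    by apply.
  - apply: integrableJ; apply: continuousJM; last exact: continuousJ_cst.
    exact: continuousJ_norm.
  move=> a a11; rewrite [h _ * _]mulrC -mulrBr normrM ler_wpM2l//.
  exact: gerr.
rewrite RintegralZr//; last by apply: integrableJ; exact: continuousJ_norm.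
apply: le_trans (ler_wpM2r c0 (K_norm s11)) _.
rewrite /c mulrCA ler_wpM2l// mulr_sumr; apply: ler_sum => j _.
by rewrite -exprS.
Qed.
End tensor.

(** * Continuous functions on the cube are measurable *)

Lemma measurable_fun_countable_comp d (X : measurableType d)
    d' (Y : measurableType d') (T : countType) (kappa : X -> T) (F : T -> Y) :
  (forall k, measurable [set x | kappa x = k]) ->
  measurable_fun setT (F \o kappa).
Proof.
move=> mk _ A _; rewrite setTI.
rewrite (_ : _ @^-1` A =
    \bigcup_(p in [set p | if unpickle p is Some k then A (F k) else False])
    (if unpickle p is Some k then [set x | kappa x = k] else set0)).
  by apply: bigcup_measurable => p _; case: unpickle.
apply/seteqP; split=> [x Ax|x [p /=]].
  by exists (pickle (kappa x)); rewrite /= pickleK.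
by case: unpickle => // k Ak /= ->.
Qed.

Section row_functions.
Context (R : realType) (N : nat).
Local Notation J := `[(-1 : R), 1]%classic.
Local Notation mu := (@lebesgue_measure R).
Local Notation tup n := (n.-tuple (measurableTypeR R)).
Local Notation row t := (@row_of_tuple R N t).

Lemma row_of_tuple_cube : (@row_of_tuple R N) @^-1` cube R N = box R N.
Proof.
by apply/seteqP; split => t h j; have := h j; rewrite /= /row_of_tuple mxE in_itv.
Qed.

Definition grid_index (m : nat) (t : tup N) : {ffun 'I_N -> int} :=
  [ffun i => Num.floor (m.+1%:R * (tnth t i : R))].

Lemma measurable_grid_cell m k : measurable [set t | grid_index m t = k].
Proof.
have m0 : 0 < m.+1%:R :> R by rewrite ltr0n.
rewrite (_ : [set _ | _] = \bigcap_(i in [set: 'I_N]) ((@tnth _ _)^~ i @^-1`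
   `[(k i)%:~R / m.+1%:R, (k i + 1)%:~R / m.+1%:R[%classic)).
  apply: fin_bigcap_measurable => [|i _]; first exact: finite_finset.
  by rewrite -[X in measurable X]setTI; exact: measurable_tnth.
apply/seteqP; split => [t /= <- i _|t h] /=.
  rewrite in_itv/= ffunE ler_pdivrMr// ltr_pdivlMr//.
  by rewrite ![tnth t i * _]mulrC; exact: floor_itv.
apply/ffunP => i; rewrite ffunE; apply: floor_def.
by have := h i I; rewrite /= in_itv/= ler_pdivrMr// ltr_pdivlMr// mulrC.
Qed.

Definition grid_point m (k : {ffun 'I_N -> int}) : 'rV[R]_N :=
  \row_i ((k i)%:~R / m.+1%:R).

Lemma grid_point_index m (t : tup N) i :
  tnth t i - m.+1%:R^-1 < grid_point m (grid_index m t) ord0 i <= tnth t i.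
Proof.
have m0 : 0 < m.+1%:R :> R by rewrite ltr0n.
rewrite mxE ffunE ltr_pdivlMr// ler_pdivrMr// mulrBl mulVf ?gt_eqF// mulrC.
have := floor_itv (m.+1%:R * tnth t i).
by rewrite intrD => /andP[-> h]; rewrite andbT ltrBlDr.
Qed.

Lemma grid_point_cube m (t : tup N) :
  box R N t -> cube R N (grid_point m (grid_index m t)).
Proof.
move=> ht i; have m0 : 0 < m.+1%:R :> R by rewrite ltr0n.
have := ht i; rewrite /= in_itv/= => /andP[t1 t2].
rewrite mxE ffunE ler_pdivlMr// ler_pdivrMr// mul1r mulN1r.
have := floor_itv (m.+1%:R * tnth t i) => /andP[h1 _].
apply/andP; split; last by apply: le_trans h1 _; rewrite -[leRHS]mulr1 ler_wpM2l.
rewrite (_ : - m.+1%:R = (- m.+1%:Z)%:~R); last by rewrite intrN.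
rewrite ler_int floor_ge_int intrN.
by rewrite -mulrN1 ler_wpM2l.
Qed.

(** Extension by zero makes the function measurable and bounded everywhere, so
    that its sections are too. *)
Definition cube_patch (f : 'rV[R]_N -> R) : tup N -> R :=
  (f \o @row_of_tuple R N) \_ (box R N).

(** Tuples carry a product sigma-algebra but no topology, so continuity is
    exploited through rounding: the values of [f] at the grid points below [t]
    converge to [f] at [t], and each approximant takes countably many values
    on measurable cells. *)
Lemma measurable_cube_patch (f : 'rV[R]_N -> R) : {within cube R N, continuous f} ->
  measurable_fun setT (cube_patch f).
Proof.
move=> cf.
apply: (measurable_restrictT (f \o @row_of_tuple R N) (@measurable_box R N)).1.
pose h m (t : tup N) := f (grid_point m (grid_index m t)).
have mh m : measurable_fun (box R N) (h m).
  apply: measurable_funTS.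
  exact: (@measurable_fun_countable_comp _ (tup N) _ (measurableTypeR R) _
    (grid_index m) (fun k => f (grid_point m k)) (@measurable_grid_cell m)).
suff hc t : box R N t -> h m t @[m --> \oo] --> f (row t).
  exact: measurable_fun_cvg mh hc.
move=> ht.
have tc : cube R N (row t) by rewrite -[cube _ _ _]/((_ @^-1` _) t) row_of_tuple_cube.
have /subspace_continuousP/(_ _ tc) cft := cf.
apply: cvg_comp cft => A /nbhs_ballP[e /= e0 eA].
near=> m.
apply: eA; last exact: grid_point_cube.
split => // i j; rewrite (ord1 i) {i}.
rewrite /ball/= [row t ord0 j]mxE.
have /andP[h1 h2] := grid_point_index m t j.
have h3 : m.+1%:R^-1 < e by near: m; exact: near_infty_natSinv_lt (PosNum e0).
by rewrite ger0_norm ?subr_ge0//; apply: lt_trans h3; rewrite ltrBlDl -ltrBlDr.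
Unshelve. all: by end_near. Qed.
End row_functions.

(** * The Galerkin projection as an integral operator *)

Lemma Rintegral_sum d (T : measurableType d) (R : realType)
    (mu : {measure set T -> \bar R}) (D : set T) (I : finType) (F : I -> T -> R) :
  measurable D -> (forall i, mu.-integrable D (EFin \o F i)) ->
  \int[mu]_(t in D) (\sum_i F i t) = \sum_i \int[mu]_(t in D) F i t.
Proof.
move=> mD iF; rewrite /Rintegral.
under eq_integral do rewrite -sumEFin.
rewrite integral_sum//.
apply: EFin_inj; rewrite fineK; last first.
  by apply/sum_fin_numP => i _ _; apply: integrable_fin_num => //; exact: iF.
rewrite -sumEFin; apply: eq_bigr => i _.
by rewrite fineK//; apply: integrable_fin_num => //; exact: iF.
Qed.

Section galerkin.
Context (R : realType) (N : nat).
Local Notation J := `[(-1 : R), 1]%classic.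
Local Notation mu := (@lebesgue_measure R).
Local Notation tup n := (n.-tuple (measurableTypeR R)).
Local Notation row t := (@row_of_tuple R N t).
Local Notation P k := (normalized_legendre R k).
Local Notation cube := (cube R N).
Local Notation open_cube := (open_cube R N).

Lemma compact_cube : compact cube.
Proof.
have -> : cube = [set x | forall i, J (x ord0 i)].
  by apply/seteqP; split => x h j; have := h j; rewrite /= in_itv.
by apply: (@rV_compact R N (fun=> J)) => i; exact: segment_compact.
Qed.

Lemma cube_bounded (f : 'rV[R]_N -> R) : {within cube, continuous f} ->
  exists2 B, 0 < B & forall x, cube x -> `|f x| <= B.
Proof.
move=> cf.
have J0 : cube !=set0 by exists 0 => j; rewrite mxE; lra.
have [c _ cm] := compact_EVT_max J0 compact_cube (within_continuous_norm cf).
exists (`|f c| + 1); first by rewrite ltr_wpDl.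
by move=> t Jt; apply: ler_wpDr => //; apply: cm; rewrite inE.
Qed.

Lemma cube_patch_bounded f B : 0 <= B -> (forall x, cube x -> `|f x| <= B) ->
  forall t, `|cube_patch f t| <= B.
Proof.
move=> B0 fB t; rewrite /cube_patch /patch; case: ifPn => [/set_mem|_].
  by rewrite -row_of_tuple_cube => /fB.
by rewrite normr0.
Qed.

(** Distributing the product of the sums over [k_j <= M] yields the sum over
    all multi-indices. *)
Lemma galerkinE M f (x : tup N) : {within cube, continuous f} ->
  galerkin M f (row x) = \int[lebesgue_tuple R N]_(t in box R N)
    (cube_patch f t * tensor_kernel (fun s t => (legendre_kernel M s).[t]) x t).
Proof.
move=> cf; have [B B0 fB] := cube_bounded cf.
have fpB := cube_patch_bounded (ltW B0) fB.
have mf := measurable_cube_patch cf.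
have Pj k (t : tup N) : multi_legendre k (row t) = \prod_(j < N) (P (k j)).[tnth t j].
  by rewrite /multi_legendre; apply: eq_bigr => j _; rewrite mxE.
transitivity (\int[lebesgue_tuple R N]_(t in box R N)
    \sum_(k : {ffun 'I_N -> 'I_M.+1})
      multi_legendre (fun j => k j) (row x) *
      (cube_patch f t * multi_legendre (fun j => k j) (row t))); last first.
  apply: eq_Rintegral => t _; rewrite /tensor_kernel.
  under [in RHS]eq_bigr do rewrite legendre_kernelE.
  rewrite bigA_distr_bigA/= mulr_sumr; apply: eq_bigr => k _.
  by rewrite mulrCA !Pj -big_split.
have ik (k : 'I_N -> nat) : (lebesgue_tuple R N).-integrable (box R N)
    (EFin \o (fun t => cube_patch f t * multi_legendre k (row t))).
  apply: (integrable_box (B := B * \prod_(j < N) (k j).+1%:R)).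
    apply: measurable_funM => //.
    under eq_fun do rewrite Pj.
    apply: measurable_prod => j _.
    apply: (measurableT_comp _ (measurable_tnth j)).
    exact: continuous_measurable_fun (@continuous_horner _ _).
  move=> t ht; rewrite normrM ler_pM// Pj normr_prod; apply: ler_prod => j _.
  by rewrite normr_ge0 normr_normalized_legendre_le//; exact: ht.
rewrite Rintegral_sum; first 1 last.
- exact: measurable_box.
- move=> k; have := ik (fun j => k j).
  have := @integrableZl _ _ R (lebesgue_tuple R N) _ (@measurable_box R N).
  by move=> H /(H (multi_legendre (fun j => k j) (row x))).
apply: eq_bigr => k _; rewrite RintegralZl//; last exact: measurable_box.
rewrite mulrC; congr (_ * _).
rewrite /legendre_coef /cube_integral row_of_tuple_cube.
by apply: eq_Rintegral => t ht; rewrite /cube_patch /patch ht.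
Qed.
End galerkin.

(** * Smooth functions along a coordinate direction *)

Section directional.
Context (R : realType) (N : nat) (j : 'I_N).
Local Notation J := `[(-1 : R), 1]%classic.
Local Notation cube := (cube R N).
Local Notation open_cube := (open_cube R N).
Implicit Types (x : 'rV[R]_N) (f g : 'rV[R]_N -> R).

Definition row_line x (t : R) : 'rV[R]_N := \row_i (if i == j then t else x ord0 i).

Lemma row_line_cube x t : cube x -> J t -> cube (row_line x t).
Proof. by move=> cx; rewrite /= in_itv/= => Jt i; rewrite mxE; case: eqP => _. Qed.

Lemma row_line_open_cube x t : open_cube x -> -1 < t < 1 -> open_cube (row_line x t).
Proof. by move=> cx Jt i; rewrite mxE; case: eqP => _. Qed.

Lemma open_cubeW x : open_cube x -> cube x.
Proof. by move=> cx i; have /andP[? ?] := cx i; rewrite !ltW. Qed.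

Lemma row_lineD x t h : row_line x (h + t) = h *: delta_mx ord0 j + row_line x t.
Proof.
apply/rowP => i; rewrite !mxE eqxx /= eq_sym.
by case: eqP => _; rewrite ?mulr1 ?mulr0 ?add0r.
Qed.

Lemma row_line_id x : row_line x (x ord0 j) = x.
Proof. by apply/rowP => i; rewrite mxE; case: eqP => // ->. Qed.

Lemma continuous_row_line x : continuous (row_line x).
Proof.
move=> t; have -> : row_line x = (fun s => s *: delta_mx ord0 j + row_line x 0).
  by apply/funext => s; rewrite -row_lineD addr0.
apply: cvgD; last exact: cvg_cst.
by apply: cvgZr_tmp; exact: cvg_id.
Qed.

Lemma continuousJ_row_line f x : {within cube, continuous f} -> cube x ->
  continuousJ (f \o row_line x).
Proof.
move=> cf cx; apply/subspace_continuousP => t Jt.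
have /subspace_continuousP/(_ _ (row_line_cube cx Jt)) := cf.
apply: cvg_trans => A /= fA.
have lA := (@continuous_row_line x t) _ fA.
suff : \forall s \near t, J s -> A ((f \o row_line x) s) by [].
have {}lA : \forall s \near t, cube (row_line x s) -> A (f (row_line x s)) by exact: lA.
by apply: filterS lA => s H Js; apply: H; exact: row_line_cube.
Qed.

Lemma is_derive_row_line f x (d t : R) :
  is_derive (row_line x t) (delta_mx ord0 j) f d -> is_derive t 1 (f \o row_line x) d.
Proof.
have E : (fun h : R => h^-1 *:
      ((f \o row_line x \o shift t) (h *: 1) - (f \o row_line x) t)) =
    (fun h => h^-1 *:
      ((f \o shift (row_line x t)) (h *: delta_mx ord0 j) - f (row_line x t))).
  by apply/funext => h /=; rewrite -row_lineD [h *: 1]mulr1.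
by move=> [df dE]; apply: DeriveDef; rewrite /derivable /derive E.
Qed.

(** Only repeated derivatives in the direction [j] are recorded: they are all
    that the Sturm-Liouville operator in the [j]-th coordinate uses. *)
Fixpoint Ck_along (m : nat) f : Prop :=
  {within cube, continuous f} /\
  match m with
  | 0 => True
  | m'.+1 => exists df : 'rV[R]_N -> R,
      (forall x, open_cube x -> is_derive x (delta_mx ord0 j) f (df x)) /\
      Ck_along m' df
  end.

Lemma Ck_cube_along m f : Ck_cube m f -> Ck_along m f.
Proof.
elim: m f => [|m IH] f [cf H]; split => //.
by have [df [H1 H2]] := H j; exists df; split => //; exact: IH.
Qed.

Lemma Ck_along_continuous m f : Ck_along m f -> {within cube, continuous f}.
Proof. by case: m => [|m] []. Qed.

Lemma Ck_alongW m f : Ck_along m.+1 f -> Ck_along m f.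
Proof.
elim: m f => [|m IH] f; first by move=> [? _]; split.
by move=> [cf [df [H1 H2]]]; split => //; exists df; split => //; exact: IH.
Qed.

Lemma Ck_alongD m f g : Ck_along m f -> Ck_along m g -> Ck_along m (fun x => f x + g x).
Proof.
elim: m f g => [|m IH] f g [cf Hf] [cg Hg].
  by split => // x; apply: continuousD; [exact: cf|exact: cg].
split; first by move=> x; apply: continuousD; [exact: cf|exact: cg].
have [df [df1 df2]] := Hf; have [dg [dg1 dg2]] := Hg.
exists (fun x => df x + dg x); split; last exact: IH.
by move=> x ox; have := df1 x ox; have := dg1 x ox => ? ?; exact: is_deriveD.
Qed.

Lemma Ck_alongZ m (c : R) f : Ck_along m f -> Ck_along m (fun x => c * f x).
Proof.
elim: m f => [|m IH] f [cf Hf].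
  by split => // x; apply: continuousM; [exact: cvg_cst|exact: cf].
split; first by move=> x; apply: continuousM; [exact: cvg_cst|exact: cf].
have [df [df1 df2]] := Hf.
exists (fun x => c * df x); split; last exact: IH.
by move=> x ox; have := df1 x ox => ?; exact: is_deriveZ.
Qed.

Lemma Ck_along_coord m f : Ck_along m f -> Ck_along m (fun x => x ord0 j * f x).
Proof.
have cj : {within cube, continuous (fun x : 'rV[R]_N => x ord0 j)}.
  by apply: continuous_subspaceT => x; exact: coord_continuous.
elim: m f => [|m IH] f Hf; have cf := Ck_along_continuous Hf.
  by split => // x; apply: continuousM; [exact: cj|exact: cf].
split; first by move=> x; apply: continuousM; [exact: cj|exact: cf].
have [_ [df [df1 df2]]] := Hf.
exists (fun x => f x + x ord0 j * df x); split; last first.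
  by apply: Ck_alongD; [exact: Ck_alongW|exact: IH].
move=> x ox; have := df1 x ox => dfx.
have dx : is_derive x (delta_mx ord0 j) (fun x : 'rV[R]_N => x ord0 j) (1 : R).
  have q1 : (fun h : R => h^-1 *: (((fun y : 'rV[R]_N => y ord0 j) \o shift x)
      (h *: delta_mx ord0 j) - x ord0 j)) @ 0^' --> (1 : R).
    apply: cvg_near_cst; near=> h.
    rewrite /= !mxE !eqxx mulr1 addrK /GRing.scale/= mulVf//.
    near: h; exact: nbhs_dnbhs_neq.
  by apply: DeriveDef; [exact: cvgP q1|exact: cvg_lim q1].
rewrite (_ : _ + _ = x ord0 j *: df x + f x *: 1).
  exact: is_deriveM.
by rewrite /GRing.scale/= mulr1 addrC.
Unshelve. all: by end_near. Qed.

(** [G] is the [q]-fold image of [f] under the Sturm-Liouville operator in the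
    [j]-th coordinate; it is one function on the cube, so it bounds the
    coefficients on all segments at once. *)
Lemma Ck_along_legendre_coef1 q f : Ck_along (2 * q) f ->
  exists2 G, {within cube, continuous G} & forall x k, open_cube x ->
    ((k * k.+1) ^ q)%:R * legendre_coef1 (f \o row_line x) k =
    legendre_coef1 (G \o row_line x) k.
Proof.
elim: q f => [|q IH] f Hf.
  exists f; first exact: Ck_along_continuous Hf.
  by move=> x k _; rewrite expn0 mul1r.
rewrite mulnS in Hf; have [cf [f1 [df [cf1 [f2 [df1 Hf2]]]]]] := Hf.
have cf2 := Ck_along_continuous Hf2.
have Hf1 : Ck_along (2 * q).+1 f1 by split => //; exists f2.
pose Lf (x : 'rV[R]_N) := 2 * (x ord0 j * f1 x) +
  (-1 * f2 x + x ord0 j * (x ord0 j * f2 x)).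
have [|G cG HG] := IH Lf.
  apply: Ck_alongD; first by apply: Ck_alongZ; apply: Ck_along_coord; exact: Ck_alongW.
  by apply: Ck_alongD; [exact: Ck_alongZ|do 2 apply: Ck_along_coord].
exists G => // x k ox; have cx := open_cubeW ox.
rewrite -HG// expnSr natrM -mulrA; congr (_ * _).
transitivity (legendre_coef1 (sturm_liouville (f1 \o row_line x) (f2 \o row_line x)) k).
  apply: legendre_coef1_sturm_liouville; try exact: continuousJ_row_line.
    by move=> t t11; apply: is_derive_row_line; apply: df; exact: row_line_open_cube.
  by move=> t t11; apply: is_derive_row_line; apply: df1; exact: row_line_open_cube.
congr legendre_coef1; apply/funext => t.
by rewrite /sturm_liouville /Lf /= mxE eqxx; ring.
Qed.

(** [|P_k| <= (1 + P_k^2) / 2] and [P_k] has norm one. *)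
Lemma legendre_coef1_le (u : R -> R) B k : continuousJ u ->
  (forall t, J t -> `|u t| <= B) -> `|legendre_coef1 u k| <= B * 2.
Proof.
move=> cu uB; have J0 : J 0 by rewrite /= in_itv/=; lra.
have B0 : 0 <= B by apply: le_trans (uB 0 J0).
have cP : continuousJ (horner (normalized_legendre R k)) by exact: continuousJ_horner.
have cuP : continuousJ (fun t => u t * (normalized_legendre R k).[t]).
  exact: continuousJM.
have cP2 : continuousJ
    (fun t => (normalized_legendre R k * normalized_legendre R k).[t]).
  exact: continuousJ_horner.
apply: le_trans (normr_integralJ cuP) _.
apply: (@le_trans _ _ (\int[@lebesgue_measure R]_(t in J)
    (B / 2 * (1 + (normalized_legendre R k * normalized_legendre R k).[t])))).
  apply: le_integralJ; first exact: continuousJ_norm.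
    apply: continuousJM; first exact: continuousJ_cst.
    by apply: continuousJD => //; exact: continuousJ_cst.
  move=> t Jt; rewrite normrM hornerM -mulrA (le_trans (ler_wpM2r _ (uB t Jt)))//.
  rewrite ler_wpM2l// -expr2 -[_.[t] ^+ 2]real_normK ?num_real//.
  move: `|_| => y; have := sqr_ge0 (y - 1).
  have -> : (y - 1) ^+ 2 = y ^+ 2 - 2 * y + 1 by ring.
  lra.
rewrite integralJZ; last by apply: continuousJD => //; exact: continuousJ_cst.
rewrite integralJD//; last exact: continuousJ_cst.
rewrite integralJ_cst normalized_legendre_orthonormal eqxx mulr1n; lra.
Qed.

Lemma Ck_along_coef_decay q f : Ck_along (2 * q) f ->
  exists B, forall x k, open_cube x ->
    `|legendre_coef1 (f \o row_line x) k| * ((k * k.+1) ^ q)%:R <= B.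
Proof.
move=> /Ck_along_legendre_coef1[G cG HG]; have [B B0 GB] := cube_bounded cG.
exists (B * 2) => x k ox; have cx := open_cubeW ox.
rewrite mulrC -[X in X * _]ger0_norm// -normrM HG//.
apply: legendre_coef1_le; first exact: continuousJ_row_line.
by move=> t Jt; apply: GB; exact: row_line_cube.
Qed.
End directional.

(** * Uniform convergence of the Galerkin approximations *)

Section galerkin_rate.
Context (R : realType) (N : nat).
Local Notation J := `[(-1 : R), 1]%classic.
Local Notation mu := (@lebesgue_measure R).
Local Notation tup n := (n.-tuple (measurableTypeR R)).
Local Notation row t := (@row_of_tuple R N t).
Local Notation cube := (cube R N).
Local Notation open_cube := (open_cube R N).

Lemma row_of_tuple_line (x : tup N) j s : row (tuple_line x j s) = row_line j (row x) s.
Proof. by apply/rowP => i; rewrite !mxE tnth_mktuple. Qed.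

Lemma row_of_row (x : 'rV[R]_N) : row [tuple x ord0 i | i < N] = x.
Proof. by apply/rowP => i; rewrite mxE tnth_mktuple. Qed.

(** With [r = N - 1] in [legendre_sum_rate], the one-dimensional error absorbs
    the growth [(M + 1)^(N - 1)] of the iterated kernels. *)
Lemma galerkin_rate_open l (f : 'rV[R]_N -> R) :
  (N + 2 <= 2 * l./2)%N -> (0 < N)%N -> Ck_cube l f ->
  exists C, forall M x, (0 < M)%N -> open_cube x ->
    `|galerkin M f x - f x| <= C / M%:R.
Proof.
move=> lN N0 Cf; have cf : {within cube, continuous f} by case: (l) Cf => [|?] [].
have [B0 B00 fB0] := cube_bounded cf.
have /choice[B BP] : forall j, exists B, forall x k, open_cube x ->
    `|legendre_coef1 (f \o row_line j x) k| * ((k * k.+1) ^ l./2)%:R <= B.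
  move=> j; apply: Ck_along_coef_decay.
  have : Ck_along j l f by exact: Ck_cube_along.
  have : (2 * l./2 <= l)%N by rewrite mul2n -[leqRHS]odd_double_half leq_addl.
  move: (2 * _)%N => m; elim: l {Cf lN} => [|l IH]; first by rewrite leqn0 => /eqP ->.
  rewrite leq_eqVlt => /predU1P[-> //|]; rewrite ltnS => ml Hl.
  by apply: IH => //; exact: Ck_alongW.
pose Bm := \sum_j `|B j|.
have BBm j : B j <= Bm.
  by rewrite (le_trans (ler_norm _))// /Bm (bigD1 j)//= lerDl sumr_ge0.
have Bm0 : 0 <= Bm by apply: sumr_ge0.
exists (Bm * N%:R) => M x M0 ox; pose tx : tup N := [tuple x ord0 i | i < N].
have M0' : 0 < M%:R :> R by rewrite ltr0n.
have M10' : 0 < M.+1%:R :> R by rewrite ltr0n.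
have tx11 : open_box tx by move=> i; rewrite tnth_mktuple.
have fpE (t : tup N) : box R N t -> cube_patch f t = f (row t).
  by move=> ht; rewrite /cube_patch /patch mem_set.
have open_boxW (y : tup N) : open_box y -> box R N y.
  by move=> h i; rewrite /= in_itv/=; have /andP[? ?] := h i; rewrite !ltW.
rewrite -(row_of_row x) galerkinE// -fpE; last exact: open_boxW.
pose K (s t : R) := (legendre_kernel M s).[t].
pose eps := Bm / (M%:R * M.+1%:R ^+ N.-1).
apply: (@le_trans _ _ (eps * \sum_(j < N) M.+1%:R ^+ j)); last first.
  have : \sum_(j < N) (M.+1%:R : R) ^+ j <= N%:R * M.+1%:R ^+ N.-1.
    have -> : N%:R * M.+1%:R ^+ N.-1 = \sum_(j < N) M.+1%:R ^+ N.-1 :> R.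
      by rewrite sumr_const card_ord mulr_natl.
    apply: ler_sum => j _; rewrite ler_weXn2l// ?ler1n//.
    by rewrite -ltnS prednK.
  have eps0 : 0 <= eps by rewrite divr_ge0// mulr_ge0 ?exprn_ge0// ltW.
  move=> /(ler_wpM2l eps0) h; apply: le_trans h _.
  rewrite le_eqVlt; apply/predU1P; left.
  rewrite /eps; field.
  by rewrite expf_neq0 ?gt_eqF.
apply: (@tensor_error R K M.+1%:R eps _ _ _ N (cube_patch f) B0) => //.
- by move=> s; exact: continuousJ_horner.
- by move=> s; exact: continuous_measurable_fun (@continuous_horner _ _).
- move=> s s11; apply: integral_legendre_kernel_norm.
  by rewrite /= in_itv/=; move: s11 => /andP[? ?]; rewrite !ltW.
- exact: measurable_cube_patch.
- exact: cube_patch_bounded (ltW B00) fB0.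
move=> y j y11; rewrite fpE; last exact: open_boxW.
have yc : open_cube (row y) by move=> i; rewrite mxE.
pose u := f \o row_line j (row y).
have cu : continuousJ u by apply: continuousJ_row_line => //; exact: open_cubeW.
have -> : f (row y) = u (tnth y j).
  by rewrite /u /= -[X in f X](row_line_id j) mxE.
have -> : \int[mu]_(t in J) (cube_patch f (tuple_line y j t) * K (tnth y j) t) =
    (legendre_sum u M).[tnth y j].
  transitivity (\int[mu]_(t in J) (u t * (legendre_kernel M (tnth y j)).[t])).
    apply: eq_Rintegral => t /set_mem Jt; rewrite fpE ?row_of_tuple_line//.
    move=> i; rewrite tnth_mktuple; case: eqP => // _.
    exact: (open_boxW _ y11).
  rewrite integral_legendre_kernel// horner_sum.
  by apply: eq_bigr => k _; rewrite [RHS]hornerZ.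
apply: (@legendre_sum_rate _ u Bm l./2 N.-1) => //; first by lia.
by move=> k; apply: le_trans (BBm j); exact: BP.
Qed.
End galerkin_rate.

Section closed_cube.
Context (R : realType) (N : nat).
Local Notation cube := (cube R N).
Local Notation open_cube := (open_cube R N).

Lemma continuous_galerkin M (f : 'rV[R]_N -> R) : continuous (galerkin M f).
Proof.
apply: continuous_big => [|k _ x]; first exact: add_continuous.
have cm : continuous (@multi_legendre R N (fun j => k j)).
  apply: (@continuous_big _ _ _ _ _ mul_continuous _ _
    (fun j (y : 'rV[R]_N) => (normalized_legendre R (k j)).[y ord0 j])) => j _ y.
  apply: (@continuous_comp _ _ _ (fun y : 'rV[R]_N => y ord0 j)
    (horner (normalized_legendre R (k j)))); first exact: coord_continuous.
  exact: continuous_horner.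
exact: cvgM (cvg_cst _) (cm x).
Qed.

(** Shrinking a point of the cube towards the origin moves it into the open
    cube. *)
Lemma le_closed_cube (g : 'rV[R]_N -> R) c : {within cube, continuous g} ->
  (forall x, open_cube x -> g x <= c) -> forall x, cube x -> g x <= c.
Proof.
move=> cg gc x cx; rewrite leNgt; apply/negP => cgx.
have /subspace_continuousP/(_ x cx)/cvgr_gt/(_ c cgx) := cg.
move=> /nbhs_ballP[e /= e0 eP].
(* Half of the minimum, because both [d < e] and [d < 1] must be strict. *)
pose d := Num.min e 1 / 2; have d0 : 0 < d by rewrite divr_gt0// lt_min e0 ltr01.
have d1 : d < 1 by rewrite /d ltr_pdivrMr// mul1r gt_min; apply/orP; right; lra.
have de : d < e by rewrite /d ltr_pdivrMr// gt_min; apply/orP; left; lra.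
have oy : open_cube ((1 - d) *: x).
  by move=> j; rewrite mxE; have /andP[? ?] := cx j; apply/andP; split; nra.
have := gc _ oy; rewrite leNgt => /negP; apply; apply: eP; last exact: open_cubeW.
split => // i j; rewrite (ord1 i) /ball/= mxE.
have -> : x ord0 j - (1 - d) * x ord0 j = d * x ord0 j by ring.
rewrite normrM gtr0_norm// (le_lt_trans _ de)// ler_piMr ?(ltW d0)//.
by rewrite ler_norml; exact: cx.
Qed.

Lemma galerkin_rate l (f : 'rV[R]_N -> R) :
  (N + 2 <= 2 * l./2)%N -> (0 < N)%N -> Ck_cube l f ->
  exists C, forall M x, (0 < M)%N -> cube x ->
    `|galerkin M f x - f x| <= C / M%:R.
Proof.
move=> lN N0 Cf; have cf : {within cube, continuous f} by case: (l) Cf => [|?] [].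
have [C CP] := galerkin_rate_open lN N0 Cf; exists C => M x M0.
have cd : {within cube, continuous (fun y => galerkin M f y - f y)}.
  move=> y; apply: continuousB; last exact: cf.
  exact: (continuous_subspaceT (@continuous_galerkin M f)).
have cn : {within cube, continuous (fun y => `|galerkin M f y - f y|)}.
  exact: within_continuous_norm cd.
by apply: (le_closed_cube cn) => y; exact: CP.
Qed.
End closed_cube.

(** * Minimizers of perturbed sums of squares *)

Section perturbed_zero.
Context (R : realType) (N : nat).
Local Notation cube := (cube R N).
Variables (f : 'I_N -> 'rV[R]_N -> R) (g : nat -> 'I_N -> 'rV[R]_N -> R).
Variables (z : 'rV[R]_N) (C : R).
Hypotheses (fc : forall i, {within cube, continuous (f i)})
  (gc : forall M i, {within cube, continuous (g M i)})
  (zc : cube z) (fz : forall i, f i z = 0)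
  (z_unique : forall x, cube x -> \sum_(i < N) f i x ^+ 2 = 0 -> x = z)
  (fg : forall M i x, (0 < M)%N -> cube x -> `|g M i x - f i x| <= C / M%:R).

Let sumsq (h : 'I_N -> 'rV[R]_N -> R) x := \sum_(i < N) h i x ^+ 2.

Let continuous_sumsq h : (forall i, {within cube, continuous (h i)}) ->
  {within cube, continuous (sumsq h)}.
Proof.
move=> hc; apply: (@continuous_big _ _ _ _ _ add_continuous (subspace cube) _
  (fun i x => h i x ^+ 2)) => i _ x.
by apply: continuousM; exact: hc.
Qed.

Let sumsq_ge0 h x : 0 <= sumsq h x.
Proof. by apply: sumr_ge0 => i _; exact: sqr_ge0. Qed.

Let minimizer_ex M : exists x, is_minimizer cube (sumsq (g M)) x.
Proof.
have [||c /set_mem cc cP] := compact_EVT_min _ _ (continuous_sumsq (@gc M)).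
- by exists z.
- exact: compact_cube.
by exists c; split => // y cy; apply: cP; exact/mem_set.
Qed.

Let minimizer_residual M x i : (0 < M)%N -> is_minimizer cube (sumsq (g M)) x ->
  `|g M i x| <= N%:R * (C / M%:R).
Proof.
move=> M0 [cx xmin].
have N1 : 1 <= N%:R :> R by rewrite ler1n (leq_trans _ (ltn_ord i)).
have e0 : 0 <= C / M%:R by apply: le_trans (fg i M0 zc).
have Ne0 : 0 <= N%:R * (C / M%:R) by exact: mulr_ge0 (ler0n _ _) e0.
rewrite -(@ler_pXn2r _ 2) ?nnegrE// real_normK ?num_real//.
apply: (@le_trans _ _ (sumsq (g M) x)).
  by rewrite /sumsq (bigD1 i)//= lerDl sumr_ge0// => k _; rewrite sqr_ge0.
apply: le_trans (xmin z zc) _.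
apply: (@le_trans _ _ (\sum_(k < N) (C / M%:R) ^+ 2)).
  apply: ler_sum => k _; have := fg k M0 zc; rewrite fz subr0 => h.
  by rewrite -[leLHS]real_normK ?num_real// lerXn2r// nnegrE.
rewrite sumr_const card_ord -[_ *+ N]mulr_natl; move: (C / M%:R) => e.
rewrite exprMn ler_wpM2r ?sqr_ge0//.
by rewrite expr2 ler_peMl.
Qed.

Let e_cvg (A : R) : A / M%:R @[M --> \oo] --> (0 : R).
Proof.
rewrite -(mulr0 A); apply: cvgM; first exact: cvg_cst.
apply/gtr0_cvgV0; last exact: cvgr_idn.
by near=> M; rewrite ltr0n; near: M; exists 1%N.
Unshelve. all: by end_near. Qed.

Theorem perturbed_minimizers_cvg :
  exists theta : nat -> 'rV[R]_N,
    [/\ forall M : nat,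
          is_minimizer cube (fun x => \sum_(i < N) g M i x ^+ 2) (theta M),
        theta M @[M --> \oo] --> z &
        (\row_i g M i (theta M)) @[M --> \oo] --> (0 : 'rV[R]_N)].
Proof.
have /choice[theta tP] := minimizer_ex.
exists theta; split => //; last first.
  apply/cvg_ballP => e e0; near=> M.
  split => // i j; rewrite (ord1 i) /ball/= !mxE sub0r normrN.
  apply: le_lt_trans (minimizer_residual j _ (tP M)) _.
    by near: M; exists 1%N.
  rewrite mulrA; apply: le_lt_trans (ler_norm _) _.
  by near: M; apply: cvgr0_norm_lt => //; exact: e_cvg.
apply/cvg_ballP => e e0.
pose U := (ball z e)^°; pose A := cube `&` ~` U.
have zU : U z by exact: nbhsx_ballx.
have cA : compact A.
  apply: compact_closedI; first exact: compact_cube.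
  by apply: open_closedC; exact: open_interior.
suff UP : \forall M \near \oo, U (theta M).
  by apply: filterS UP => M; exact: interior_subset.
have [A0|/set0P A0] := eqVneq A set0.
  near=> M; apply: contrapT => nU.
  have : A (theta M) by split => //; case: (tP M).
  by rewrite A0.
have fA : {within A, continuous (sumsq f)}.
  by apply: continuous_subspaceW (continuous_sumsq fc) => x [].
have [c /set_mem[cc cU] cmin] := compact_EVT_min A0 cA fA.
have c0 : 0 < sumsq f c.
  rewrite lt0r sumsq_ge0 andbT; apply/eqP => /(z_unique cc) cz.
  by apply: cU; rewrite cz.
near=> M; apply: contrapT => nU.
have M0 : (0 < M)%N by near: M; exists 1%N.
have [ct _] := tP M.
have : sumsq f c <= sumsq f (theta M) by apply: cmin; apply/mem_set; split.
apply/negP; rewrite -ltNge.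
pose D := (N%:R + 1) * C.
apply: (@le_lt_trans _ _ (\sum_(i < N) (D / M%:R) ^+ 2)).
  apply: ler_sum => i _; have h1 := fg i M0 ct.
  have h2 := minimizer_residual i M0 (tP M).
  have eM0 : 0 <= C / M%:R by apply: le_trans h1.
  have h3 : `|f i (theta M)| <= D / M%:R.
    rewrite /D -mulrA mulrDl mul1r -[f i _](subrK (g M i (theta M))) addrC.
    by rewrite (le_trans (ler_normD _ _))// lerD// distrC.
  by rewrite -[leLHS]real_normK ?num_real// lerXn2r// nnegrE (le_trans _ h3).
rewrite sumr_const card_ord -[_ *+ N]mulr_natl expr2.
near: M; have : N%:R * (D / M%:R * (D / M%:R)) @[M --> \oo] --> N%:R * (0 * 0 : R).
  by apply: cvgM; [exact: cvg_cst|apply: cvgM; exact: e_cvg].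
by rewrite !mulr0 => /cvgr_lt; exact.
Unshelve. all: by end_near. Qed.
End perturbed_zero.

Theorem theorem3p1 (R : realType) (N : nat) (l : nat)
    (f : 'I_N -> 'rV[R]_N -> R) (thetad : 'rV[R]_N)
    (N_ge1 : (1 <= N)%N)
    (l_def : (l%:Z = Num.ceil (3 / 2 * N%:R : R) + 2)%R)
    (f_Cl : forall i, Ck_cube l (f i))
    (thetad_int : open_cube R N thetad)
    (thetad_min :
      is_minimizer (cube R N) (fun theta => \sum_(i < N) f i theta ^+ 2) thetad)
    (thetad_unique : forall theta : 'rV[R]_N,
      is_minimizer (cube R N) (fun theta => \sum_(i < N) f i theta ^+ 2) theta ->
      theta = thetad)
    (f_thetad : forall i, f i thetad = 0)
    (jacobian_inv : 'J (fun theta => \row_i f i theta) thetad \in unitmx) :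
  exists theta : nat -> 'rV[R]_N,
    [/\ forall M : nat, is_minimizer (cube R N)
          (fun x => \sum_(i < N) galerkin M (f i) x ^+ 2) (theta M),
        theta M @[M --> \oo] --> thetad &
        (\row_i galerkin M (f i) (theta M)) @[M --> \oo] --> (0 : 'rV[R]_N)].
Proof.
have cf i : {within cube R N, continuous (f i)} by case: (l) (f_Cl i) => [|?] [].
(* One derivative is lost when [l] is odd, since the Sturm-Liouville operator
   consumes two at a time. *)
have lN : (N + 2 <= 2 * l./2)%N.
  have : 3 / 2 * N%:R <= (Num.ceil (3 / 2 * N%:R : R))%:~R :> R by exact: ceil_ge.
  have -> : Num.ceil (3 / 2 * N%:R : R) = l%:Z - 2 by rewrite l_def addrK.
  rewrite intrB => h.
  have h2 : (3 * N + 4)%:R <= (2 * l)%:R :> R.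
    rewrite natrD !natrM; move: h; rewrite -[l%:~R]/(l%:R); lra.
  have := odd_double_half l; move: h2; rewrite ler_nat; lia.
have /choice[C CP] : forall i, exists C : R, forall M x, (0 < M)%N -> cube R N x ->
    `|galerkin M (f i) x - f i x| <= C / M%:R.
  by move=> i; exact: galerkin_rate lN N_ge1 (f_Cl i).
apply: (@perturbed_minimizers_cvg R N f (fun M i => galerkin M (f i)) thetad
  (\sum_i `|C i|)) => //.
- by move=> M i; apply: continuous_subspaceT; exact: continuous_galerkin.
- by case: thetad_min.
- move=> x cx fx0; apply: thetad_unique; split => // y _.
  by rewrite fx0 sumr_ge0// => i _; exact: sqr_ge0.
- move=> M i x M0 cx; apply: le_trans (CP i M x M0 cx) _.
  rewrite ler_wpM2r// (le_trans (ler_norm _))// (bigD1 i)//= lerDl.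
  exact: sumr_ge0.
Qed.
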